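(* The biharmonic potential of the Gaussian admits the following one-dimensional integral representations. For $n=3$ and all $\mathbf x\in\mathbb R^3$, $$\mathcal B_3(e^{-|\cdot|^2})(\mathbf x)=-\frac18\int_0^\infty e^{-|\mathbf x|^2/(1+t)}\left(\frac{1}{(1+t)^{3/2}}+\frac{t\,|\mathbf x|^2}{(1+t)^{5/2}}\right)dt,$$ and for every $n\ge5$ and all $\mathbf x\in\mathbb R^n$, $$\mathcal B_n(e^{-|\cdot|^2})(\mathbf x)=\frac1{16}\int_0^\infty\frac{e^{-|\mathbf x|^2/(1+t)}}{(1+t)^{n/2}}\,t\,dt .$$
   Context: For $n\ge3$, $n\neq4$, the biharmonic potential is $$\mathcal B_n f(\mathbf x)=\frac{\Gamma(n/2)}{4\pi^{n/2}(n-2)(n-4)}\int_{\mathbb R^n}\frac{f(\mathbf y)}{|\mathbf x-\mathbf y|^{n-4}}\,d\mathbf y,\qquad \mathbf x\in\mathbb R^n .$$ *)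

(* Defs.v *)
From HB Require Import structures.
From mathcomp Require Import all_boot all_order all_algebra.
From mathcomp Require Import all_classical all_reals all_analysis.

Set Implicit Arguments.
Unset Strict Implicit.
Unset Printing Implicit Defensive.
Import Order.TTheory GRing.Theory Num.Theory.
Import numFieldNormedType.Exports.

Local Open Scope classical_set_scope.
Local Open Scope ring_scope.

(* Elements of R^n are tuples, carrying the library's product sigma-algebra. *)
Notation Rn R n := (n.-tuple (measurableTypeR R)).

(* The product measure on R * R^n, transported to R^(n+1) by consing. *)
Section cons_measure.
Context (R : realType) (n : nat).

Definition cons_Rn (p : measurableTypeR R * Rn R n) : Rn R n.+1 :=
  [tuple of p.1 :: p.2].

Definition uncons_Rn (x : Rn R n.+1) : measurableTypeR R * Rn R n :=
  (thead x, [tuple of behead x]).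

Lemma cons_RnK : cancel cons_Rn uncons_Rn.
Proof.
by move=> [a x]; rewrite /uncons_Rn /cons_Rn/= theadE; congr pair; exact/val_inj.
Qed.

Lemma uncons_RnK : cancel uncons_Rn cons_Rn.
Proof. by move=> x; rewrite [RHS]tuple_eta; exact/val_inj. Qed.

Lemma measurable_cons_Rn : measurable_fun [set: _] cons_Rn.
Proof. exact: measurable_cons. Qed.

Lemma measurable_uncons_Rn : measurable_fun [set: _] uncons_Rn.
Proof.
by apply/measurable_fun_pairP; split;
  [exact: measurable_tnth|exact: measurable_behead].
Qed.

Variable mu : {sigma_finite_measure set (Rn R n) -> \bar R}.

HB.instance Definition _ :=
  @isMeasurableFun.Build _ _ _ _ cons_Rn measurable_cons_Rn.

Definition cons_measure : set (Rn R n.+1) -> \bar R :=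
  pushforward (@lebesgue_measure R \x mu)%E cons_Rn.

Let cons_measure0 : cons_measure set0 = 0%E.
Proof. exact: measure0. Qed.

Let cons_measure_ge0 A : (0 <= cons_measure A)%E.
Proof. exact: measure_ge0. Qed.

Let cons_measure_semi_sigma_additive : semi_sigma_additive cons_measure.
Proof. exact: measure_semi_sigma_additive. Qed.

HB.instance Definition _ := isMeasure.Build _ _ _ cons_measure
  cons_measure0 cons_measure_ge0 cons_measure_semi_sigma_additive.

Let sigma_finite_cons_measure : sigma_finite setT cons_measure.
Proof.
have /sigma_finiteP[F [TF ndF Ffin]] := sigma_finiteT (@lebesgue_measure R).
have /sigma_finiteP[G [TG ndG Gfin]] := sigma_finiteT mu.
exists (fun k => uncons_Rn @^-1` (F k `*` G k)).
  rewrite -preimage_bigcup -[LHS](preimage_setT uncons_Rn); congr (_ @^-1` _).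
  rewrite -setXTT TF TG predeqE => -[x y]; split.
    move=> [/= [i _ Fix] [j _ Gjy]]; exists (maxn i j) => //; split.
    - by move: x Fix; exact/subsetPset/ndF/leq_maxl.
    - by move: y Gjy; exact/subsetPset/ndG/leq_maxr.
  by move=> [i _ []/= ? ?]; split; exists i.
move=> k; have [mF Fk] := Ffin k; have [mG Gk] := Gfin k; split.
  rewrite -[X in measurable X]setTI; apply: measurable_uncons_Rn => //.
  exact: measurableX.
rewrite /cons_measure /pushforward.
rewrite (_ : _ @^-1` _ = F k `*` G k); last first.
  transitivity ((uncons_Rn \o cons_Rn) @^-1` (F k `*` G k)) => //.
  by rewrite (_ : _ \o _ = id)//; apply/funext => p; exact: cons_RnK.
by rewrite product_measure1E// lte_mul_pinfty// ge0_fin_numE.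
Qed.

HB.instance Definition _ := Measure_isSigmaFinite.Build _ _ _
  cons_measure sigma_finite_cons_measure.

End cons_measure.

Fixpoint lebesgue_Rn (R : realType) (n : nat) :
    {sigma_finite_measure set (Rn R n) -> \bar R} :=
  if n is m.+1 then [the {sigma_finite_measure set _ -> \bar R} of
                     cons_measure (lebesgue_Rn R m)]
  else [the {sigma_finite_measure set _ -> \bar R} of
        \d_([tuple] : Rn R 0)].

(* Together with sigma-finiteness, this characterizes Lebesgue measure on R^n. *)
Lemma lebesgue_Rn_box (R : realType) (n : nat)
    (A : 'I_n -> set (measurableTypeR R)) :
  (forall i, measurable (A i)) ->
  (lebesgue_Rn R n [set x | forall i, A i (tnth x i)] =
   \prod_(i < n) @lebesgue_measure R (A i))%E.
Proof.
elim: n A => [|n IHn] A mA.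
  rewrite big_ord0 /= diracE mem_set//=.
  by case.
rewrite big_ord_recl -IHn// -product_measure1E//; last first.
  rewrite (_ : [set _ | _] = \bigcap_(i in [set: 'I_n])
      ((fun x : Rn R n => tnth x i) @^-1` A (lift ord0 i))); last first.
    by apply/seteqP; split => x /= h i; [move=> _|]; exact: h.
  apply: fin_bigcap_measurable => // i _; rewrite -[X in measurable X]setTI.
  exact: measurable_tnth.
rewrite /= /cons_measure /pushforward; congr product_measure1.
apply/seteqP; split => -[a x]/= h.
  split; first exact: (h ord0).
  by move=> i; move: (h (lift ord0 i)); rewrite tnthS/=; congr (A _ _).
case: h => h0 h i; case: (unliftP ord0 i) => [j ->|->//].
by rewrite tnthS; exact: h.
Qed.

Section biharmonic.
Context (R : realType).

Definition norm_Rn (n : nat) (x : Rn R n) : R :=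
  Num.sqrt (\sum_(i < n) (tnth x i : R) ^+ 2).

Definition sub_Rn (n : nat) (x y : Rn R n) : Rn R n :=
  [tuple ((tnth x i : R) - (tnth y i : R)) | i < n].

Definition gauss_Rn (n : nat) (y : Rn R n) : R := expR (- norm_Rn y ^+ 2).

Definition Gamma (s : R) : R :=
  \int[lebesgue_measure]_(t in `]0%R, +oo[) (t `^ (s - 1) * expR (- t)).

(* The integer power makes |x - y|^(n - 4) the reciprocal of |x - y| when n = 3;
   at y = x the quotient is 0 for n <> 4. *)
Definition biharmonic_integrand (n : nat) (f : Rn R n -> R) (x y : Rn R n) : R :=
  f y / norm_Rn (sub_Rn x y) ^ (n%:Z - 4).

Definition biharmonic_potential (n : nat) (f : Rn R n -> R) (x : Rn R n) : R :=
  Gamma (n%:R / 2) / (4 * pi `^ (n%:R / 2) * (n%:R - 2) * (n%:R - 4)) *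
  \int[lebesgue_Rn R n]_y biharmonic_integrand f x y.

End biharmonic.

(* Main.v *)
(* Proof idea. With r = |x - y|^2 and s = n/2 - 2, the kernel r^(-s) is, up to
   the factor Gamma(s), the superposition of the Gaussians t^(-s-1) exp(-r/t),
   t > 0; for n = 3 the kernel sqrt r is, up to 2 Gamma(1/2), the superposition
   of t^(-1/2) (1 - exp(-r/t)). By Tonelli it remains to integrate over y a
   product of two Gaussians, which splits over the coordinates and gives
   (pi t / (1 + t))^(n/2) exp(-|x|^2 / (1 + t)). For n >= 5 this is the announced
   integrand; for n = 3 it differs from it by an exact derivative. The constants
   match because Gamma(s + 1) = s Gamma(s). *)

(* The identities are proved between integrals of nonnegative functions, with values in [[0, +oo]],
   where Tonelli and monotone convergence ask for no integrability. Integrability of the potential's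
   integrand comes out at the end, because the one-dimensional integrand is at most a multiple of
   [(1 + t)^(-3/2)]. For this reason integration by parts is phrased with a derivative [p - q], [p]
   and [q] nonnegative, and its conclusion adds instead of subtracting. For [n >= 5] the weight
   [t^(-s-1)] meets the factor [t^(n/2)] of the Gaussian integral, and [n/2 - s - 1 = 1]: this is
   the single factor [t] of the answer, the same in every dimension. For [n = 3] the obstacle is
   decay: after integration over [y] the two parts of [1 - exp] both behave like [t^(-1/2)] at
   infinity, so they can only be treated together. The derivative that relates their difference to
   the announced integrand is that of [2 sqrt t - 2 t (1 + t)^(-1/2) exp(-|x|^2 / (1 + t))], whose
   two terms cancel at infinity. *)
Require Import Defs.
From mathcomp Require Import all_boot all_order all_algebra.
From mathcomp Require Import all_classical all_reals all_analysis measurable_realfun.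
From mathcomp Require Import ring lra.

Set Implicit Arguments.
Unset Strict Implicit.
Unset Printing Implicit Defensive.
Import Order.TTheory GRing.Theory Num.Theory.
Import numFieldNormedType.Exports.

Local Open Scope classical_set_scope.
Local Open Scope ring_scope.

(** * Integrals over the positive half-line *)

Section half_line.
Context (R : realType).
Let mu := @lebesgue_measure R.

(** The centre [c] is free because [t |-> r / t] carries the exhaustion with [c = 1] onto the one
    with [c = r]. Starting at [k.+2] keeps every interval nondegenerate. *)
Lemma itv0y_bigcup (c : R) : 0 < c ->
  `]0, +oo[%classic = \bigcup_k `[c / k.+2%:R, c * k.+2%:R]%classic.
Proof.
move=> c0; apply/seteqP; split => t /=.
  rewrite in_itv/= andbT => t0.
  (* Both summands are positive, so one bound on the sum controls both endpoints. *)
  have [k hk] : exists k, c / t + t / c < k%:R.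
    by exists (Num.bound (c / t + t / c));
      rewrite archi_boundP// addr_ge0// divr_ge0// ltW.
  exists k => //=; rewrite in_itv/=.
  have ct0 : 0 < c / t by exact: divr_gt0.
  have tc0 : 0 < t / c by exact: divr_gt0.
  have k2 : k%:R <= k.+2%:R :> R by rewrite ler_nat -addn2 leq_addr.
  rewrite ler_pdivrMr// mulrC -ler_pdivrMr// [c * _]mulrC -[X in _ && X]ler_pdivrMr//.
  by apply/andP; split; lra.
move=> [k _] /=; rewrite !in_itv/= andbT => /andP[+ _].
by apply: lt_le_trans; rewrite divr_gt0.
Qed.

Lemma cvg_integral_0y (f : R -> \bar R) (c : R) : 0 < c ->
  measurable_fun (`]0%R, +oo[%classic : set R) f -> (forall t : R, (0 < t)%R -> (0 <= f t)%E) ->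
  (\int[mu]_(t in `[(c / k.+2%:R)%R, (c * k.+2%:R)%R]) f t @[k --> \oo] -->
    \int[mu]_(t in `]0%R, +oo[) f t)%E.
Proof.
move=> c0 mf f0; rewrite (itv0y_bigcup c0).
have sub k : `[c / k.+2%:R, c * k.+2%:R]%classic `<=` `]0, +oo[%classic.
  by rewrite (itv0y_bigcup c0); exact: (@bigcup_sup _ _ k).
apply: ge0_nondecreasing_set_cvg_integral => //.
- apply/nondecreasing_seqP => k; apply/subsetPset.
  apply: subset_itv; rewrite bnd_simp.
    by rewrite ler_pM2l// lef_pV2 ?posrE// ler_nat.
  by rewrite ler_pM2l// ler_nat.
- by move=> k; apply: measurable_funS mf.
- by move=> k t /sub; rewrite /= in_itv/= andbT; exact: f0.
Qed.

Lemma continuous_measurable_0y (f : R -> R) :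
  (forall t : R, 0 < t -> {for t, continuous f}) -> measurable_fun (`]0%R, +oo[%classic : set R) f.
Proof.
move=> cf; apply: open_continuous_measurable_fun.
  exact: interval_open.
by move=> t; rewrite inE/= in_itv/= andbT; exact: cf.
Qed.

Lemma within_continuous_itv (f : R -> R) (a b : R) : 0 < a ->
  (forall t : R, 0 < t -> {for t, continuous f}) -> {within `[a, b], continuous f}.
Proof.
move=> a0 cf; apply: continuous_in_subspaceT => t.
by rewrite inE/= in_itv/= => /andP[at_ _]; apply: cf; exact: lt_le_trans at_.
Qed.

Lemma cvg_natr_pinfty2 : (k.+2%:R : R) @[k --> \oo] --> +oo.
Proof.
have := @cvgr_idn R; rewrite -(cvg_shiftn 2).
by under eq_fun do rewrite addn2.
Qed.

(* Both parts of the derivative are nonnegative, so monotone convergence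
   applies to each of them separately: no integrability is required. *)
Lemma integral_0y_FTC (H p q : R -> R) (l0 l1 : R) :
  (forall t : R, 0 < t -> 0 <= p t) -> (forall t, 0 < t -> 0 <= q t) ->
  (forall t : R, 0 < t -> {for t, continuous p}) ->
  (forall t : R, 0 < t -> {for t, continuous q}) ->
  (forall t : R, 0 < t -> is_derive t 1 H (p t - q t)) ->
  H t @[t --> 0^'+] --> l0 -> H t @[t --> +oo] --> l1 ->
  (\int[mu]_(t in `]0%R, +oo[) (p t)%:E =
   \int[mu]_(t in `]0%R, +oo[) (q t)%:E + (l1 - l0)%:E)%E.
Proof.
move=> p0 q0 cp cq dH H0 H1.
have HH (t : R) : 0 < t -> {for t, continuous H}.
  move=> t0; apply: differentiable_continuous; apply/derivable1_diffP.
  by have [] := dH t t0.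
have step k : (\int[mu]_(t in `[(1 / k.+2%:R)%R, (1 * k.+2%:R)%R]) (p t)%:E =
    \int[mu]_(t in `[(1 / k.+2%:R)%R, (1 * k.+2%:R)%R]) (q t)%:E +
    (H (1 * k.+2%:R) - H (1 / k.+2%:R))%:E)%E.
  set a := 1 / _; set b := 1 * _.
  have a0 : 0 < a by rewrite divr_gt0.
  have ab : a < b.
    by rewrite /a /b !mul1r (@lt_trans _ _ 1)// ?invf_lt1// ltr1n.
  have gta t : t \in `]a, b[ -> 0 < t.
    by rewrite in_itv/= => /andP[+ _]; exact: lt_trans.
  have ip : mu.-integrable `[a, b] (EFin \o p).
    apply: continuous_compact_integrable; first exact: segment_compact.
    exact: within_continuous_itv.
  have iq : mu.-integrable `[a, b] (EFin \o q).
    apply: continuous_compact_integrable; first exact: segment_compact.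
    exact: within_continuous_itv.
  have FTC : (\int[mu]_(x in `[a, b]) (p x - q x)%:E = (H b)%:E - (H a)%:E)%E.
    apply: continuous_FTC2 => //.
    - by apply: within_continuous_itv => // t t0;
        apply: continuousB; [exact: cp|exact: cq].
    - split.
      + by move=> t /gta /dH [].
      + by apply: cvg_at_right_filter; exact: HH.
      + by apply: cvg_at_left_filter; apply: HH; rewrite (lt_trans a0).
    - move=> t /gta t0; rewrite derive1E; have h := dH t t0.
      exact: derive_val.
  (* On [[a, b]] the integral of [q] is finite and can be moved across. In the limit it may become
     [+oo], and the additive form still makes sense since the increment of [H] is finite. *)
  have := FTC; under eq_integral do rewrite EFinB.
  rewrite integralB//=; move=> /(congr1 (fun z => z + \int[mu]_(t in `[a, b]) (q t)%:E)%E).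
  rewrite subeK ?integrable_fin_num//.
  by rewrite addeC EFinB => ->.
have mp : measurable_fun (`]0%R, +oo[%classic : set R) (EFin \o p).
  by apply/measurable_EFinP; exact: continuous_measurable_0y.
have mq : measurable_fun (`]0%R, +oo[%classic : set R) (EFin \o q).
  by apply/measurable_EFinP; exact: continuous_measurable_0y.
have p0E (t : R) : (0 < t)%R -> (0 <= (EFin \o p) t)%E.
  by move=> t0; rewrite lee_fin p0.
have q0E (t : R) : (0 < t)%R -> (0 <= (EFin \o q) t)%E.
  by move=> t0; rewrite lee_fin q0.
apply: (cvg_unique _ (cvg_integral_0y ltr01 mp p0E)) => //.
apply: cvg_trans; first by apply: near_eq_cvg; apply: nearW => k;
  apply/esym; exact: step.
apply: cvgeD => //.
- exact: fin_num_adde_defl.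
- exact: (cvg_integral_0y ltr01 mq q0E).
- apply: cvg_EFin; first exact: nearW.
  apply: cvgB.
    move/cvg_pinftyP: H1; apply; under eq_fun do rewrite mul1r.
    exact: cvg_natr_pinfty2.
  move/cvg_at_rightP: H0; apply; split; first by move=> k; rewrite divr_gt0.
  under eq_fun do rewrite mul1r.
  apply/gtr0_cvgV0; last exact: cvg_natr_pinfty2.
  exact: nearW.
Qed.
End half_line.

(** * The substitution [u = r / t] on the half-line *)

Section inversion.
Context (R : realType).
Let mu := @lebesgue_measure R.

Lemma is_derive_divr (r t : R) : 0 < t ->
  is_derive t 1 (fun t => r / t) (- (r / t ^+ 2)).
Proof.
move=> t0; have dV := is_deriveV (lt0r_neq0 t0) (is_derive_id t (1 : R)).
have h := is_deriveM (is_derive_cst r t (1 : R)) dV.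
apply: is_derive_eq.
by rewrite scaler0 addr0 scaler1 -[LHS]/(r * _) mulrN.
Qed.

(** On compact intervals this is the decreasing change of variables. Since [[1/(k+2), k+2]] is sent
    onto [[r/(k+2), r (k+2)]], the two sides are limits of one and the same sequence. *)
Lemma integral_0y_divr (G : R -> R) (r : R) : 0 < r ->
  (forall u : R, 0 < u -> 0 <= G u) ->
  (forall u : R, 0 < u -> {for u, continuous G}) ->
  (\int[mu]_(u in `]0%R, +oo[) (G u)%:E =
   \int[mu]_(t in `]0%R, +oo[) (G (r / t)%R * (r / t ^+ 2))%:E)%E.
Proof.
move=> r0 G0 cG.
pose F t := r / t.
have dF (t : R) : 0 < t -> is_derive t 1 F (- (r / t ^+ 2)) by exact: is_derive_divr.
have cF (t : R) : 0 < t -> {for t, continuous F}.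
  move=> t0; apply: differentiable_continuous; apply/derivable1_diffP.
  by have [] := dF t t0.
have cg (t : R) : 0 < t -> {for t, continuous (fun t : R => - (r / t ^+ 2))}.
  move=> t0; apply: continuousN; apply: continuousM; first exact: cst_continuous.
  by apply: continuousV; [rewrite sqrf_eq0 gt_eqF|exact: exprn_continuous].
(* The formula for the derivative is available only at positive points, hence the passage through a
   neighbourhood of [t]. *)
have cF' (t : R) : 0 < t -> {for t, continuous (derive1 F)}.
  move=> t0; rewrite /prop_for /continuous_at derive1E.
  have -> : 'D_1 F t = - (r / t ^+ 2) by have h := dF t t0; exact: derive_val.
  apply: cvg_trans; last exact: cg t0.
  apply: near_eq_cvg; near=> u.
  have u0 : 0 < u by near: u; exact: lt_nbhsr.
  by rewrite derive1E; have h := dF u u0; apply/esym; exact: derive_val.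
have mG : measurable_fun (`]0%R, +oo[%classic : set R) (EFin \o G).
  by apply/measurable_EFinP; exact: continuous_measurable_0y.
have cK (t : R) : 0 < t -> {for t, continuous (fun t : R => G (r / t) * (r / t ^+ 2))}.
  move=> t0; apply: continuousM.
    by apply: continuous_comp; [exact: cF|apply: cG; rewrite divr_gt0].
  by rewrite -[X in {for _, continuous X}]opprK; apply: continuousN; exact: cg.
have mK : measurable_fun (`]0%R, +oo[%classic : set R)
    (fun t => (G (r / t)%R * (r / t ^+ 2))%:E).
  by apply/measurable_EFinP; exact: continuous_measurable_0y.
have G0E (t : R) : (0 < t)%R -> (0 <= (EFin \o G) t)%E.
  by move=> t0; rewrite lee_fin G0.
have K0E (t : R) : (0 < t)%R -> (0 <= (G (r / t)%R * (r / t ^+ 2))%:E)%E.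
  by move=> t0; rewrite lee_fin mulr_ge0 ?G0 ?divr_ge0 ?divr_gt0 ?exprn_ge0// ltW.
apply: (cvg_unique _ (cvg_integral_0y r0 mG G0E)) => //.
apply: cvg_trans (cvg_integral_0y ltr01 mK K0E).
apply: near_eq_cvg; apply: nearW => k.
set a := 1 / _; set b := 1 * _.
have a0 : 0 < a by rewrite divr_gt0.
have ab : a < b.
  by rewrite /a /b !mul1r (@lt_trans _ _ 1)// ?invf_lt1// ltr1n.
have b0 : 0 < b by exact: lt_trans ab.
have gta (t : R) : t \in `]a, b[ -> 0 < t.
  by rewrite in_itv/= => /andP[+ _]; exact: lt_trans.
have := @integration_by_substitution_decreasing R F G a b (ltW ab).
have -> : F b = r / k.+2%:R by rewrite /F /b mul1r.
have -> : F a = r * k.+2%:R by rewrite /F /a div1r invrK.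
move=> -> //.
- apply: eq_integral => t; rewrite inE/= in_itv/= => /andP[at_ _].
  have t0 := lt_le_trans a0 at_.
  rewrite -[RHS]/((G (F t) * - (derive1 F t))%:E).
  by rewrite derive1E; have h := dF t t0; rewrite derive_val opprK.
- move=> x y; rewrite !in_itv/= => /andP[ax _] /andP[ay _] xy.
  have x0 := lt_le_trans a0 ax; have y0 := lt_le_trans a0 ay.
  by rewrite ltr_pM2l// ltf_pV2.
- by move=> t /gta; exact: cF'.
- apply/cvg_ex; exists (derive1 F a); apply: cvg_at_right_filter; exact: cF'.
- apply/cvg_ex; exists (derive1 F b); apply: cvg_at_left_filter; exact: cF'.
- split.
  + by move=> t /gta /dF [].
  + by apply: cvg_at_right_filter; exact: cF.
  + by apply: cvg_at_left_filter; exact: cF.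
- by apply: within_continuous_itv => //; rewrite divr_gt0.
Unshelve. all: end_near. Qed.

End inversion.

(** * The Gamma function *)

Section Gamma.
Context (R : realType).
Let mu := @lebesgue_measure R.

Lemma is_derive_continuous (f : R -> R) (x d : R) :
  is_derive x 1 f d -> {for x, continuous f}.
Proof.
by move=> [df _]; apply: differentiable_continuous; exact/derivable1_diffP.
Qed.

Lemma continuous_powR (a t : R) : 0 < t -> {for t, continuous (@powR R ^~ a)}.
Proof. by move=> t0; exact: is_derive_continuous (is_derive1_powR a t0). Qed.

Lemma is_derive_expRN (t : R) : is_derive t 1 (fun t => expR (- t)) (- expR (- t)).
Proof.
have h := is_derive1_comp (is_derive_expR (- t)) (is_deriveN (is_derive_id t (1 : R))).
refine (is_derive_eq h _); by rewrite mulrN1.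
Qed.

Lemma is_derive_mul (f g : R -> R) (x a b : R) :
  is_derive x 1 f a -> is_derive x 1 g b ->
  is_derive x 1 (fun t => f t * g t) (a * g x + f x * b).
Proof.
move=> df dg; have h := is_deriveM df dg.
refine (is_derive_eq h _); by rewrite addrC; congr (_ + _); rewrite mulrC.
Qed.

(** This is [x <= exp x] at [x = t / (2 s)], raised to the power [s]. Only half of the exponential
    is spent, so that [exp(-t/2)] is left to dominate the Gamma integrand. *)
Lemma powR_le_expR (s t : R) : 0 < s -> 0 < t ->
  t `^ s <= (2 * s) `^ s * expR (t / 2).
Proof.
move=> s0 t0; have ts0 : 0 < t / (2 * s) by rewrite divr_gt0// mulr_gt0.
have -> : expR (t / 2) = expR (t / (2 * s)) `^ s.
  by rewrite -expRM; congr expR; field; rewrite gt_eqF.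
rewrite -powRM ?expR_ge0 ?mulr_ge0 ?(ltW s0)//.
apply: ge0_ler_powR; rewrite ?nnegrE ?mulr_ge0 ?expR_ge0 ?(ltW s0) ?(ltW t0)//.
rewrite mulrC -ler_pdivrMr ?mulr_gt0//.
by apply: le_trans (expR_ge1Dx _); rewrite lerDr.
Qed.

Lemma powR_expRN_cvg0 (s : R) : 0 < s ->
  t `^ s * expR (- t) @[t --> +oo] --> 0.
Proof.
move=> s0.
apply: (@squeeze_cvgr _ _ _ _ (cst 0) (fun t : R => (2 * s) `^ s * expR (- (t / 2)))).
- near=> t; have t0 : 0 < t by near: t; exact: nbhs_pinfty_gt.
  rewrite mulr_ge0 ?powR_ge0 ?expR_ge0//=.
  apply: le_trans (ler_wpM2r (expR_ge0 _) (powR_le_expR s0 t0)) _.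
  by rewrite -mulrA -expRD ler_wpM2l ?powR_ge0// ler_expR; lra.
- exact: cvg_cst.
- rewrite -[X in _ --> X](mulr0 ((2 * s) `^ s)); apply: cvgM; first exact: cvg_cst.
  have h : (x / 2 : R) @[x --> +oo] --> +oo by apply: gt0_cvgMly => //; exact: cvg_id.
  exact: (cvg_comp _ _ h (@cvgr_expR R)).
Unshelve. all: end_near. Qed.

Let gamma_fun_ge0 (s t : R) : 0 <= t `^ s * expR (- t).
Proof. by rewrite mulr_ge0 ?powR_ge0 ?expR_ge0. Qed.

Let measurable_gamma_fun (s : R) (D : set R) :
  measurable_fun D (fun t => t `^ s * expR (- t)).
Proof.
apply: (@measurable_funS _ _ _ _ setT) => //.
apply: measurable_funM; first exact: measurable_powR.
by apply: measurableT_comp => //; exact: measurableT_comp.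
Qed.

(** Integration by parts: [t^s exp(-t)] vanishes at both ends. Stated before anything is known to be
    finite, it also transfers finiteness from the right-hand side, whose integrand is bounded near
    0, to the left, where it may be singular. *)
Lemma integral_0y_GammaS (s : R) : 0 < s ->
  (s%:E * \int[mu]_(t in `]0%R, +oo[) (t `^ (s - 1) * expR (- t))%:E =
   \int[mu]_(t in `]0%R, +oo[) (t `^ s * expR (- t))%:E)%E.
Proof.
move=> s0; rewrite -ge0_integralZl//; first last.
- by rewrite lee_fin ltW.
- by move=> t _; rewrite lee_fin.
- by apply/measurable_EFinP; exact: measurable_gamma_fun.
rewrite -[RHS]adde0 -[X in (_ + X)%E]/((0 : R)%:E) -[X in (_ + X%:E)%E](subrr 0).
apply: (@integral_0y_FTC R (fun t => t `^ s * expR (- t)) _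
  (fun t => t `^ s * expR (- t)) 0 0).
- by move=> t t0; rewrite !mulr_ge0 ?powR_ge0 ?expR_ge0// ltW.
- by move=> t t0; rewrite mulr_ge0 ?powR_ge0 ?expR_ge0.
- move=> t t0; apply: continuousM; first exact: cst_continuous.
  apply: continuousM; first exact: continuous_powR.
  exact: is_derive_continuous (is_derive_expRN t).
- move=> t t0; apply: continuousM; first exact: continuous_powR.
  exact: is_derive_continuous (is_derive_expRN t).
- move=> t t0.
  have h := is_derive_mul (is_derive1_powR s t0) (is_derive_expRN t).
  refine (is_derive_eq h _); by rewrite mulrN mulrA.
- rewrite -[X in _ --> X](mul0r (expR (- 0))); apply: cvgM; first exact: powR_cvg0.
  apply: cvg_at_right_filter; exact: is_derive_continuous (is_derive_expRN 0).
- exact: powR_expRN_cvg0.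
Qed.

Lemma integral_0y_expR_half :
  (\int[mu]_(t in `]0%R, +oo[) (expR (- (t / 2)))%:E = 2%:E)%E.
Proof.
have dE (t : R) : is_derive t 1 (fun t => expR (- (t / 2))) (- (1 / 2) * expR (- (t / 2))).
  have d2 := is_derive_mul (is_derive_id t (1 : R)) (is_derive_cst (2^-1 : R) t (1 : R)).
  have h := @is_derive1_comp R _ (fun t => t / 2) t _ _ (is_derive_expRN (t / 2)) d2.
  refine (is_derive_eq h _); by rewrite /cst mulr0 addr0; field.
transitivity (\int[mu]_(t in `]0%R, +oo[) (0 : R)%:E + (0 - - 2)%:E)%E; last first.
  by rewrite integral0 add0e sub0r opprK.
apply: (@integral_0y_FTC R (fun t => - 2 * expR (- (t / 2))) (fun t => expR (- (t / 2)))
  (fun t => 0) (- 2) 0) => //.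
- by move=> t t0; exact: is_derive_continuous (dE t).
- by move=> t t0; exact: cst_continuous.
- move=> t t0; have h := is_derive_mul (is_derive_cst (- 2 : R) t (1 : R)) (dE t).
  refine (is_derive_eq h _); by rewrite /cst; field.
- have e0 : - 2 * expR (- (0 / 2)) = - 2 :> R by rewrite mul0r oppr0 expR0 mulr1.
  rewrite -[X in _ --> X]e0; apply: cvgM; first exact: cvg_cst.
  by apply: cvg_at_right_filter; exact: is_derive_continuous (dE 0).
- rewrite -[X in _ --> X](mulr0 (- 2)); apply: cvgM; first exact: cvg_cst.
  have h : (x / 2 : R) @[x --> +oo] --> +oo by apply: gt0_cvgMly => //; exact: cvg_id.
  exact: (cvg_comp _ _ h (@cvgr_expR R)).
Qed.

Let measurable_expR_half (D : set R) :
  measurable_fun D (fun t : R => (expR (- (t / 2)))%:E).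
Proof.
apply/measurable_EFinP; apply: (@measurable_funS _ _ _ _ setT) => //.
apply: measurableT_comp => //; apply: measurableT_comp => //.
exact: measurable_funM.
Qed.

Lemma integral_0y_GammaS_lty (s : R) : 0 < s ->
  (\int[mu]_(t in `]0%R, +oo[) (t `^ s * expR (- t))%:E < +oo)%E.
Proof.
move=> s0.
apply: (@le_lt_trans _ _ ((2 * s) `^ s * 2)%:E); last exact: ltry.
rewrite EFinM -integral_0y_expR_half -ge0_integralZl//.
- apply: ge0_le_integral => //.
  + by move=> t _; rewrite lee_fin.
  + by apply/measurable_EFinP; exact: measurable_gamma_fun.
  + by apply: measurable_funeM; exact: measurable_expR_half.
  + move=> t; rewrite /= in_itv/= andbT => t0; rewrite -EFinM lee_fin.
    apply: le_trans (ler_wpM2r (expR_ge0 _) (powR_le_expR s0 t0)) _.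
    by rewrite -mulrA -expRD ler_wpM2l ?powR_ge0// ler_expR; lra.
- exact: measurable_expR_half.
- by rewrite lee_fin powR_ge0.
Qed.

Lemma integral_0y_GammaS_gt0 (s : R) : 0 < s ->
  (0 < \int[mu]_(t in `]0%R, +oo[) (t `^ s * expR (- t))%:E)%E.
Proof.
move=> s0.
(* On [[1, 2]] one has [t^s >= 1] and [exp(-t) >= exp(-2)]. *)
apply: (@lt_le_trans _ _ (\int[mu]_(t in `[1%R, 2%R]) (expR (- 2))%:E)%E).
  rewrite integral_cst//= lebesgue_measure_itv/= lte_fin ltr1n -EFinB -EFinM.
  by rewrite lte_fin mulr_gt0 ?expR_gt0// subr_gt0 ltr1n.
apply: (@le_trans _ _ (\int[mu]_(t in `[1%R, 2%R]) (t `^ s * expR (- t))%:E)%E).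
  apply: ge0_le_integral => //.
  - by apply/measurable_EFinP; exact: measurable_gamma_fun.
  - move=> t; rewrite /= in_itv/= => /andP[t1 t2]; rewrite lee_fin.
    rewrite -[leLHS]mul1r ler_pM ?expR_ge0 ?ler_expR ?lerN2//.
    by rewrite -[leLHS](powRr0 t) ler_powR// ltW.
apply: ge0_subset_integral => //.
- by apply/measurable_EFinP; exact: measurable_gamma_fun.
- by move=> t _; rewrite lee_fin.
- by move=> t; rewrite /= !in_itv/= andbT => /andP[t1 _]; exact: lt_le_trans t1.
Qed.

(** [Gamma] is the real part of an extended integral, so finiteness is what has to be shown. It
    follows from the finiteness of [s] times the integral, with no estimate at the singularity 0. *)
Lemma Gamma_int (s : R) : 0 < s ->
  (\int[mu]_(t in `]0%R, +oo[) (t `^ (s - 1) * expR (- t))%:E = (Gamma s)%:E)%E.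
Proof.
move=> s0; rewrite /Gamma /Rintegral fineK// ge0_fin_numE; last first.
  by apply: integral_ge0 => t _; rewrite lee_fin.
have := integral_0y_GammaS_lty s0; rewrite -integral_0y_GammaS//.
move: (integral _ _ _) => -[r|//|]; first by move=> _; exact: ltry.
  by rewrite gt0_muley ?lte_fin // ltxx.
by [].
Qed.

Lemma GammaS (s : R) : 0 < s -> Gamma (s + 1) = s * Gamma s.
Proof.
move=> s0; apply: EFin_inj; rewrite -Gamma_int ?addr_gt0// addrK.
by rewrite -integral_0y_GammaS// Gamma_int.
Qed.

Lemma Gamma_gt0 (s : R) : 0 < s -> 0 < Gamma s.
Proof.
move=> s0; rewrite -(pmulr_rgt0 _ s0) -GammaS// -lte_fin -Gamma_int ?addr_gt0//.
by rewrite addrK; exact: integral_0y_GammaS_gt0.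
Qed.

Lemma powRD_gt0 (t a b : R) : 0 < t -> t `^ (a + b) = t `^ a * t `^ b.
Proof. by move=> t0; rewrite powRD//; apply/implyP => _; rewrite gt_eqF. Qed.

Lemma is_derive_expRN_divr (r t : R) : 0 < t ->
  is_derive t 1 (fun t => expR (- (r / t))) (expR (- (r / t)) * (r / t ^+ 2)).
Proof.
move=> t0; have h := @is_derive1_comp R _ (fun t => r / t) t _ _
  (is_derive_expRN (r / t)) (is_derive_divr r t0).
by refine (is_derive_eq h _); rewrite mulrNN.
Qed.

Lemma continuous_powR_expRN_divr (a r t : R) : 0 < t ->
  {for t, continuous (fun t : R => t `^ a * expR (- (r / t)))}.
Proof.
move=> t0; apply: continuousM; first exact: continuous_powR.
exact: is_derive_continuous (is_derive_expRN_divr r t0).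
Qed.

(* Gamma(s) r^(-s) = \int_0^oo u^(s-1) exp(-r u) du, after u = 1/t. *)
Lemma integral_0y_Gamma_divr (s r : R) : 0 < s -> 0 < r ->
  (\int[mu]_(t in `]0%R, +oo[) (t `^ (- s - 1) * expR (- (r / t)))%:E =
   (Gamma s * r `^ (- s))%:E)%E.
Proof.
move=> s0 r0; rewrite EFinM -Gamma_int//.
rewrite (@integral_0y_divr R (fun u => u `^ (s - 1) * expR (- u)) r) //; first last.
- move=> u u0; apply: continuousM; first exact: continuous_powR.
  exact: is_derive_continuous (is_derive_expRN u).
(* The substituted integrand is [r^s t^(-s-1) exp(-r/t)]; the factor [r^s r^(-s) = 1] is inserted to
   match it. *)
transitivity (((r `^ s)%:E * \int[mu]_(t in `]0%R, +oo[)
    (t `^ (- s - 1) * expR (- (r / t)))%:E) * (r `^ (- s))%:E)%E.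
  by rewrite muleAC -EFinM -powRD_gt0// subrr powRr0 mul1e.
congr (_ * _)%E; rewrite -ge0_integralZl//.
- apply: eq_integral => t; rewrite inE/= in_itv/= andbT => t0.
  rewrite -EFinM; congr EFin; rewrite powRM ?ltW ?invr_gt0//.
  have -> : (t^-1) `^ (s - 1) = t `^ (1 - s).
    by rewrite -powR_inv1 ?ltW// -powRrM mulN1r opprB.
  rewrite [t `^ (1 - s)](_ : _ = t `^ (- s - 1) * t ^+ 2); last first.
    rewrite -powR_mulrn ?ltW// -powRD_gt0//.
    by congr powR; ring.
  rewrite powRD_gt0// powR_inv1 ?ltW//.
  by field; rewrite !gt_eqF.
- apply/measurable_EFinP; apply: continuous_measurable_0y => t t0.
  exact: continuous_powR_expRN_divr.
- by move=> t _; rewrite lee_fin mulr_ge0 ?powR_ge0 ?expR_ge0.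
- by rewrite lee_fin powR_ge0.
Qed.
End Gamma.

(** * Gaussian integrals on R^n *)

Section gauss.
Context (R : realType).
Let mu := @lebesgue_measure R.

(** Completing the square, [y^2 + (x - y)^2 / t = ((1 + t) / t) (y - x / (1 + t))^2 + x^2 / (1 +
    t)]. The integrand is thus a multiple of the normal density of mean [x / (1 + t)] and variance
    [t / (2 (1 + t))]. *)
Lemma integral_gauss_conv (x t : R) : 0 < t ->
  (\int[mu]_y (expR (- y ^+ 2) * expR (- ((x - y) ^+ 2 / t)))%:E =
   (Num.sqrt (pi * (t / (1 + t))) * expR (- (x ^+ 2 / (1 + t))))%:E)%E.
Proof.
move=> t0; have t1 : 0 < 1 + t by rewrite addr_gt0.
pose s := Num.sqrt (t / (1 + t) / 2).
have ss : s ^+ 2 = t / (1 + t) / 2 by rewrite sqr_sqrtr// !divr_ge0// ltW.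
have s0 : s != 0 by rewrite gt_eqF// sqrtr_gt0 !divr_gt0.
have p0 := normal_peak_gt0 s0.
transitivity (\int[mu]_y (((normal_peak s)^-1 * expR (- (x ^+ 2 / (1 + t))))%:E *
    (normal_pdf (x / (1 + t)) s y)%:E))%E.
  apply: eq_integral => y _; rewrite -EFinM normal_pdfE// mulrACA mulVf ?gt_eqF//.
  rewrite mul1r -!expRD; congr (expR _)%:E; rewrite ss; field.
  by rewrite !gt_eqF.
rewrite ge0_integralZl//; first last.
- by rewrite lee_fin mulr_ge0 ?expR_ge0 ?invr_ge0 ?(ltW p0).
- by move=> y _; rewrite lee_fin normal_pdf_ge0.
- by apply/measurable_EFinP; exact: measurable_normal_pdf.
rewrite integral_normal_pdf mule1 /normal_peak invrK ss.
congr (Num.sqrt _ * _)%:E.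
by rewrite -mulr_natr; field; rewrite gt_eqF.
Qed.

Lemma ge0_integral_lebesgue_RnS n (f : Rn R n.+1 -> \bar R) :
  measurable_fun setT f -> (forall y, 0 <= f y)%E ->
  (\int[lebesgue_Rn R n.+1]_y f y =
   \int[mu]_a \int[lebesgue_Rn R n]_y f (cons_Rn (a, y)))%E.
Proof.
move=> mf f0.
have mc := @measurable_cons_Rn R n.
rewrite [LHS](ge0_integral_pushforward mc)//= preimage_setT.
rewrite fubini_tonelli1//.
exact: measurableT_comp.
Qed.

Lemma ge0_integral_lebesgue_Rn_prod n (g : 'I_n -> R -> R) :
  (forall i, measurable_fun setT (g i)) -> (forall i a, 0 <= g i a) ->
  (\int[lebesgue_Rn R n]_y (\prod_(i < n) g i (tnth y i))%:E =
   \prod_(i < n) \int[mu]_a (g i a)%:E)%E.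
Proof.
elim: n g => [|n IHn] g mg g0.
  under eq_integral do rewrite big_ord0.
  by rewrite integral_dirac//= diracE mem_set// mul1e big_ord0.
have mprod m (h : 'I_m -> R -> R) : (forall i, measurable_fun setT (h i)) ->
    measurable_fun setT (fun y : Rn R m => (\prod_(i < m) h i (tnth y i))%:E).
  move=> mh; apply/measurable_EFinP; apply: measurable_prod => i _.
  by apply: measurableT_comp; [exact: mh|exact: measurable_tnth].
have gE0 i : (0 <= \int[mu]_a (g i a)%:E)%E.
  by apply: integral_ge0 => a _; rewrite lee_fin.
rewrite ge0_integral_lebesgue_RnS; first last.
- by move=> y; rewrite lee_fin prodr_ge0.
- exact: mprod.
rewrite big_ord_recl -IHn//.
have mg' := mprod n (fun i => g (lift ord0 i)) (fun i => mg _).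
rewrite -ge0_integralZr//; first last.
- by apply: integral_ge0 => y _; rewrite lee_fin prodr_ge0.
- by move=> a _; rewrite lee_fin.
- by apply/measurable_EFinP; exact: mg.
apply: eq_integral => a _; rewrite -ge0_integralZl//; first last.
- by rewrite lee_fin.
- by move=> y _; rewrite lee_fin prodr_ge0.
apply: eq_integral => y _; rewrite -EFinM; congr EFin.
rewrite big_ord_recl; congr (g _ _ * _); apply: eq_bigr => i _.
by rewrite tnthS; congr (g _ (tnth _ _)); apply/val_inj.
Qed.
End gauss.

Section gauss_Rn.
Context (R : realType).
Let mu := @lebesgue_measure R.

Lemma sqr_norm_Rn n (x : Rn R n) : norm_Rn x ^+ 2 = \sum_(i < n) (tnth x i : R) ^+ 2.
Proof. by rewrite sqr_sqrtr// sumr_ge0// => i _; exact: sqr_ge0. Qed.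

Lemma norm_Rn_ge0 n (x : Rn R n) : 0 <= norm_Rn x.
Proof. exact: sqrtr_ge0. Qed.

Lemma norm_Rn_sub_eq0 n (x y : Rn R n) : norm_Rn (sub_Rn x y) = 0 -> y = x.
Proof.
move=> /(congr1 (fun r : R => r ^+ 2)); rewrite sqr_norm_Rn expr0n/= => /eqP.
rewrite psumr_eq0 => [/allP h|i _]; last exact: sqr_ge0.
apply: eq_from_tnth => i; have := h i (mem_index_enum _).
by rewrite tnth_mktuple sqrf_eq0 subr_eq0 => /eqP.
Qed.

Lemma measurable_norm_Rn n : measurable_fun setT (@norm_Rn R n).
Proof.
apply: (@measurableT_comp _ _ _ _ _ _ (@Num.sqrt R)).
  by apply: continuous_measurable_fun; exact: sqrt_continuous.
apply: measurable_sum => i; apply: measurable_funX; exact: measurable_tnth.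
Qed.

Lemma measurable_norm_Rn_sub n (x : Rn R n) :
  measurable_fun setT (fun y => norm_Rn (sub_Rn x y)).
Proof.
apply: measurableT_comp; first exact: measurable_norm_Rn.
apply/measurable_fun_tnthP => i.
rewrite (_ : _ \o _ = fun y : Rn R n => (tnth x i : R) - (tnth y i : R)).
  by apply: measurable_funB => //; exact: measurable_tnth.
by apply/funext => y; rewrite /= tnth_mktuple.
Qed.

Lemma gauss_Rn_ge0 n (y : Rn R n) : 0 <= gauss_Rn y.
Proof. exact: expR_ge0. Qed.

Lemma gauss_RnE n (y : Rn R n) :
  gauss_Rn y = \prod_(i < n) expR (- (tnth y i : R) ^+ 2).
Proof. by rewrite /gauss_Rn sqr_norm_Rn -sumrN expR_sum. Qed.

Lemma measurable_gauss_Rn n : measurable_fun setT (@gauss_Rn R n).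
Proof.
apply: measurableT_comp => //; apply: measurableT_comp => //.
by apply: measurable_funX; exact: measurable_norm_Rn.
Qed.

Lemma powR_half_natr (w : R) n : 0 <= w -> w `^ (n%:R / 2) = Num.sqrt w ^+ n.
Proof.
by move=> w0; rewrite mulrC powRrM powR12_sqrt// powR_mulrn// sqrtr_ge0.
Qed.

Lemma integral_gauss_Rn n :
  (\int[lebesgue_Rn R n]_y (gauss_Rn y)%:E = (pi `^ (n%:R / 2))%:E)%E.
Proof.
under eq_integral do rewrite gauss_RnE.
rewrite (@ge0_integral_lebesgue_Rn_prod R n (fun _ a => expR (- a ^+ 2))).
- under eq_bigr do rewrite integralT_gauss.
  by rewrite prodEFin prodr_const card_ord powR_half_natr ?pi_ge0.
- move=> _; apply: measurableT_comp => //; exact: measurableT_comp.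
- by move=> _ a; exact: expR_ge0.
Qed.

Lemma integral_gauss_Rn_conv n (x : Rn R n) (t : R) : 0 < t ->
  (\int[lebesgue_Rn R n]_y
     (gauss_Rn y * expR (- (norm_Rn (sub_Rn x y) ^+ 2 / t)))%:E =
   ((pi * (t / (1 + t))) `^ (n%:R / 2) *
    expR (- (norm_Rn x ^+ 2 / (1 + t))))%:E)%E.
Proof.
move=> t0.
pose g (i : 'I_n) (a : R) : R := expR (- a ^+ 2) * expR (- (((tnth x i : R) - a) ^+ 2 / t)).
have gE y : gauss_Rn y * expR (- (norm_Rn (sub_Rn x y) ^+ 2 / t)) =
    \prod_(i < n) g i (tnth y i).
  rewrite gauss_RnE sqr_norm_Rn mulr_suml -sumrN expR_sum -big_split.
  by apply: eq_bigr => i _; rewrite tnth_mktuple.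
under eq_integral do rewrite gE.
rewrite ge0_integral_lebesgue_Rn_prod.
- under eq_bigr do rewrite integral_gauss_conv//.
  rewrite prodEFin big_split prodr_const card_ord powR_half_natr; last first.
    by rewrite mulr_ge0 ?pi_ge0 ?divr_ge0 ?addr_ge0 ?ltW.
  by rewrite -expR_sum sumrN -mulr_suml sqr_norm_Rn.
- move=> i; apply: measurable_funM.
    by apply: measurableT_comp => //; exact: measurableT_comp.
  apply: measurableT_comp => //; apply: measurableT_comp => //.
  apply: measurable_funM => //; apply: measurable_funX.
  exact: measurable_funB.
- by move=> i a; rewrite mulr_ge0 ?expR_ge0.
Qed.

(** A point is a box with degenerate sides; in dimension 0 it would have mass 1. This allows the
    point [y = x] to be ignored in the potential. *)
Lemma lebesgue_Rn_set1 n (x : Rn R n) : (0 < n)%N -> lebesgue_Rn R n [set x] = 0%E.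
Proof.
move=> n0; rewrite (_ : [set x] = [set y | forall i, [set tnth x i] (tnth y i)]).
  rewrite (@lebesgue_Rn_box R n (fun i => [set tnth x i])); last by move=> i; exact: measurable_set1.
  by rewrite (bigD1 (Ordinal n0))//= lebesgue_measure_set1 mul0e.
apply/seteqP; split => [y ->//|y h]; apply: eq_from_tnth => i; exact: h.
Qed.

(** Stated for a general weight and profile to serve both superpositions: essentially [t^(-s-1)]
    with [exp(-u)], and [t^(-1/2)] with [1 - exp(-u)]. *)
Lemma gauss_Rn_tonelli n (x : Rn R n) (w E : R -> R) :
  measurable_fun setT w -> measurable_fun setT E ->
  (forall t, 0 < t -> 0 <= w t) -> (forall u, 0 <= u -> 0 <= E u) ->
  (\int[lebesgue_Rn R n]_y \int[mu]_(t in `]0%R, +oo[)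
     (gauss_Rn y * (w t * E (norm_Rn (sub_Rn x y) ^+ 2 / t)%R))%:E =
   \int[mu]_(t in `]0%R, +oo[) \int[lebesgue_Rn R n]_y
     (gauss_Rn y * (w t * E (norm_Rn (sub_Rn x y) ^+ 2 / t)%R))%:E)%E.
Proof.
move=> mw mE w0 E0.
pose r y := norm_Rn (sub_Rn x y) ^+ 2.
pose P : set (measurableTypeR R) := `]0%R, +oo[%classic.
(* The indicator makes the integrand nonnegative on the whole product space. The inverse of [t] is
   written as a real power, which is measurable on the whole line and agrees with it for [t > 0]. *)
pose f (p : Rn R n * measurableTypeR R) : \bar R :=
  (\1_P p.2 * (gauss_Rn p.1 * (w p.2 * E (r p.1 * p.2 `^ (-1)))))%:E.
have fE y (t : R) : 0 < t ->
    f (y, t) = (gauss_Rn y * (w t * E (r y / t)))%:E.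
  move=> t0; rewrite /f/= indicE mem_set ?mul1r ?powR_inv1 ?ltW//.
  by rewrite /P/= in_itv/= t0.
have f0 y (t : R) : ~ P t -> f (y, t) = 0%E.
  by move=> Pt; rewrite /f/= indicE memNset// mul0r.
have f_ge0 p : (0 <= f p)%E.
  have [Pp|Pp] := pselect (P p.2); last by rewrite [p]surjective_pairing f0.
  have t0 : 0 < p.2 by move: Pp; rewrite /P/= in_itv/= andbT.
  rewrite [p]surjective_pairing fE// lee_fin !mulr_ge0 ?gauss_Rn_ge0 ?w0//.
  by rewrite E0// divr_ge0 ?sqr_ge0 ?ltW.
have mf : measurable_fun setT f.
  apply/measurable_EFinP; apply: measurable_funM.
    apply: (@measurableT_comp _ _ _ _ _ _ (\1_P : measurableTypeR R -> R) _ snd) => //.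
    by apply: measurable_indic; exact: measurable_itv.
  apply: measurable_funM.
    by apply: measurableT_comp => //; exact: measurable_gauss_Rn.
  apply: measurable_funM.
    exact: measurableT_comp.
  apply: measurableT_comp => //; apply: measurable_funM.
    apply: (@measurableT_comp _ _ _ _ _ _ r) => //.
    by apply: measurable_funX; exact: measurable_norm_Rn_sub.
  apply: (@measurableT_comp _ _ _ _ _ _
    (fun t : measurableTypeR R => (t : R) `^ (-1)) _ snd) => //.
transitivity (\int[lebesgue_Rn R n]_y \int[mu]_t f (y, t))%E.
  apply: eq_integral => y _; rewrite integral_mkcond; apply: eq_integral => t _.
  rewrite patchE; case: ifPn => [|/negP tP].
    by rewrite inE/= in_itv/= andbT => t0; rewrite fE.
  by rewrite f0// => Pt; apply: tP; rewrite inE.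
rewrite fubini_tonelli// [RHS]integral_mkcond; apply: eq_integral => t _.
rewrite patchE; case: ifPn => [|/negP tP].
  by rewrite inE/= in_itv/= andbT => t0; apply: eq_integral => y _; rewrite fE.
by rewrite integral0_eq// => y _; rewrite f0// => Pt; apply: tP; rewrite inE.
Qed.

End gauss_Rn.

(** * The one-dimensional integrals *)

Section sqrt_representation.
Context (R : realType).
Let mu := @lebesgue_measure R.

Lemma sqrtV_cvg0 (c : R) : c / Num.sqrt t @[t --> +oo] --> 0.
Proof.
rewrite -[X in _ --> X](mulr0 c); apply: cvgM; first exact: cvg_cst.
apply/gtr0_cvgV0.
  by near=> t; rewrite sqrtr_gt0; near: t; exact: nbhs_pinfty_gt.
apply/cvgryPge => A; near=> t.
apply: (@le_trans _ _ `|A|); first exact: ler_norm.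
rewrite -sqrtr_sqr ler_sqrt; last by near: t; exact: nbhs_pinfty_ge.
by near: t; apply: nbhs_pinfty_ge; exact: num_real.
Unshelve. all: end_near. Qed.

Lemma sqrt_cvg0 (c : R) : c * Num.sqrt t @[t --> 0^'+] --> 0.
Proof.
have e : c * Num.sqrt 0 = 0 :> R by rewrite sqrtr0 mulr0.
rewrite -[X in _ --> X]e; apply: cvg_at_right_filter.
by apply: cvgM; [exact: cvg_cst|exact: sqrt_continuous].
Qed.

Lemma is_derive_1D_sqrt (t : R) : 0 <= t ->
  is_derive t 1 (fun t => Num.sqrt (1 + t)) (2 * Num.sqrt (1 + t))^-1.
Proof.
move=> t0; have t1 : 0 < 1 + t by rewrite ltr_wpDr.
have h1 := is_deriveD (is_derive_cst (1 : R) t (1 : R)) (is_derive_id t (1 : R)).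
have h := @is_derive1_comp R _ (fun t => 1 + t) t _ _ (is_derive1_sqrt t1) h1.
by refine (is_derive_eq h _); rewrite add0r mulr1.
Qed.

Lemma is_derive_1D_inv (t : R) : 0 <= t ->
  is_derive t 1 (fun t => (1 + t)^-1) (- (1 + t) ^- 2).
Proof.
move=> t0; have t1 : 1 + t != 0 by rewrite gt_eqF// ltr_wpDr.
have h1 := is_deriveD (is_derive_cst (1 : R) t (1 : R)) (is_derive_id t (1 : R)).
have h := @is_deriveV R (fun t => 1 + t) t _ _ t1 h1.
by refine (is_derive_eq h _); rewrite add0r scaler1.
Qed.

Lemma is_derive_expRN_1D (a t : R) : 0 <= t ->
  is_derive t 1 (fun t => expR (- (a / (1 + t))))
    (expR (- (a / (1 + t))) * (a / (1 + t) ^+ 2)).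
Proof.
move=> t0.
have h1 := is_derive_mul (is_derive_cst a t (1 : R)) (is_derive_1D_inv t0).
have h := @is_derive1_comp R _ (fun t => a / (1 + t)) t _ _
  (is_derive_expRN (a / (1 + t))) h1.
by refine (is_derive_eq h _); rewrite mul0r add0r/= mulrN mulrNN.
Qed.

Lemma powR_3half (w : R) : 0 <= w -> w `^ (3 / 2) = w * Num.sqrt w.
Proof.
move=> w0; rewrite powR_half_natr// exprS sqr_sqrtr// mulrC//.
Qed.

Lemma powR_5half (w : R) : 0 <= w -> w `^ (5 / 2) = w ^+ 2 * Num.sqrt w.
Proof.
move=> w0; rewrite powR_half_natr// exprSr; congr (_ * _).
by rewrite (exprM _ 2 2) sqr_sqrtr.
Qed.

(* [sqrt r] is not a superposition of the decreasing functions [exp (- r / t)],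
   but it is one of [1 - exp (- r / t)]. *)
Lemma integral_0y_sqrt (r : R) : 0 <= r ->
  (\int[mu]_(t in `]0%R, +oo[) ((Num.sqrt t)^-1 * (1 - expR (- (r / t))))%:E =
   (2 * Gamma 2^-1 * Num.sqrt r)%:E)%E.
Proof.
move=> r_ge0; have [r0|r0] := eqVneq r 0.
  rewrite r0 sqrtr0 mulr0; apply: integral0_eq => t _.
  by rewrite mul0r oppr0 expR0 subrr mulr0.
have {r_ge0}r0 : 0 < r by rewrite lt_neqAle eq_sym r0.
have e_le1 (t : R) : 0 < t -> 0 <= 1 - expR (- (r / t)).
  by move=> t0; rewrite subr_ge0 -expR0 ler_expR oppr_le0 divr_ge0// ltW.
have cE (t : R) : 0 < t -> {for t, continuous (fun t : R => 1 - expR (- (r / t)))}.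
  move=> t0; apply: continuousB; first exact: cst_continuous.
  exact: is_derive_continuous (is_derive_expRN_divr r t0).
(* Integration by parts with [2 sqrt t] as primitive of [t^(-1/2)]. What remains is
   [2 r t^(-3/2) exp(-r/t)], the Gamma superposition at [s = 1/2], whose integral is
   [2 r Gamma(1/2) r^(-1/2)]. *)
transitivity (\int[mu]_(t in `]0%R, +oo[)
    (2 * r * (t `^ (- 2^-1 - 1) * expR (- (r / t))))%:E + (0 - 0 : R)%:E)%E.
  apply: (@integral_0y_FTC R (fun t => 2 * Num.sqrt t * (1 - expR (- (r / t))))
    (fun t => (Num.sqrt t)^-1 * (1 - expR (- (r / t))))
    (fun t => 2 * r * (t `^ (- 2^-1 - 1) * expR (- (r / t)))) 0 0).
  - by move=> t t0; rewrite mulr_ge0 ?e_le1 ?invr_ge0 ?sqrtr_ge0.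
  - by move=> t t0; rewrite !mulr_ge0 ?powR_ge0 ?expR_ge0 ?(ltW r0).
  - move=> t t0; apply: continuousM; last exact: cE.
    by apply: continuousV; [rewrite gt_eqF ?sqrtr_gt0|exact: sqrt_continuous].
  - move=> t t0; apply: continuousM; first exact: cst_continuous.
    exact: continuous_powR_expRN_divr.
  - move=> t t0.
    have h1 := is_derive_mul (is_derive_cst (2 : R) t (1 : R)) (is_derive1_sqrt t0).
    have h2 : is_derive t 1 (fun t : R => 1 - expR (- (r / t))) _ :=
      is_deriveB (is_derive_cst (1 : R) t (1 : R)) (is_derive_expRN_divr r t0).
    have h := is_derive_mul h1 h2.
    refine (is_derive_eq h _).
    have -> : t `^ (- 2^-1 - 1) = (t * Num.sqrt t)^-1.
      rewrite powRD_gt0// powRN powR12_sqrt ?powR_inv1 ?ltW//.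
      by rewrite invfM mulrC.
    have st : 0 < Num.sqrt t by rewrite sqrtr_gt0.
    have tE : t = Num.sqrt t ^+ 2 by rewrite sqr_sqrtr// ltW.
    set E := expR _; set u := Num.sqrt t in st tE *.
    rewrite tE /cst. field.
    by rewrite gt_eqF.
  - apply: (@squeeze_cvgr _ _ _ _ (cst 0) (fun t : R => 2 * Num.sqrt t)).
    + near=> t; have t0 : 0 < t by near: t; exact: nbhs_right_gt.
      rewrite !mulr_ge0 ?e_le1 ?sqrtr_ge0//= ler_piMr ?mulr_ge0 ?sqrtr_ge0//.
    + exact: cvg_cst.
    + exact: sqrt_cvg0.
  (* The bound comes from [1 - exp(-u) <= u] at [u = r / t]. *)
  - apply: (@squeeze_cvgr _ _ _ _ (cst 0) (fun t : R => (2 * r) / Num.sqrt t)).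
    + near=> t; have t0 : 0 < t by near: t; exact: nbhs_pinfty_gt.
      rewrite !mulr_ge0 ?e_le1 ?sqrtr_ge0//=.
      have st : 0 < Num.sqrt t by rewrite sqrtr_gt0.
      rewrite -!mulrA ler_pM2l// ler_pdivlMr// mulrAC -expr2 sqr_sqrtr ?(ltW t0)//.
      rewrite mulrC -ler_pdivlMr// lerBlDr -lerBlDl.
      exact: expR_ge1Dx.
    + exact: cvg_cst.
    + exact: sqrtV_cvg0.
rewrite subrr adde0; under eq_integral do rewrite EFinM.
rewrite ge0_integralZl//; first last.
- by rewrite lee_fin mulr_ge0// ltW.
- by move=> t _; rewrite lee_fin mulr_ge0 ?powR_ge0 ?expR_ge0.
- apply/measurable_EFinP; apply: continuous_measurable_0y => t t0.
  exact: continuous_powR_expRN_divr.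
rewrite integral_0y_Gamma_divr ?invr_gt0// -EFinM; congr EFin.
rewrite powRN powR12_sqrt ?ltW//.
have sr : 0 < Num.sqrt r by rewrite sqrtr_gt0.
have rE : r = Num.sqrt r ^+ 2 by rewrite sqr_sqrtr// ltW.
rewrite {1}rE; field.
by rewrite gt_eqF.
Unshelve. all: end_near. Qed.
End sqrt_representation.

(** * Dimension 3: comparison of two integrands by an exact derivative *)

Section dimension3_integrand.
Context (R : realType).
Let mu := @lebesgue_measure R.

Definition gauss3_integrand (a t : R) : R := expR (- (a / (1 + t))) *
      (1 / (1 + t) `^ (3 / 2) + t * a / (1 + t) `^ (5 / 2)).

(** With [a = |x|^2], this is what the integration over [y] in [R^3] produces from the weight
    [t^(-1/2)] and the profile [1 - exp(-u)], up to the factor [pi^(3/2)]. *)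
Definition gauss_sqrt_kernel (a t : R) : R :=
  (Num.sqrt t)^-1 - t / ((1 + t) * Num.sqrt (1 + t)) * expR (- (a / (1 + t))).

Lemma gauss3_integrandE (a t : R) : 0 <= t ->
  gauss3_integrand a t = expR (- (a / (1 + t))) *
    (((1 + t) * Num.sqrt (1 + t))^-1 + t * a / ((1 + t) ^+ 2 * Num.sqrt (1 + t))).
Proof.
by move=> t0; rewrite /gauss3_integrand powR_3half ?powR_5half ?addr_ge0// mul1r.
Qed.

Lemma gauss3_integrand_ge0 (a t : R) : 0 <= a -> 0 <= t -> 0 <= gauss3_integrand a t.
Proof.
move=> a0 t0; rewrite /gauss3_integrand.
by rewrite mulr_ge0 ?expR_ge0// addr_ge0 ?divr_ge0 ?mulr_ge0 ?powR_ge0.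
Qed.

Lemma continuous_1D_sqrt (t : R) : 0 <= t ->
  {for t, continuous (fun t : R => Num.sqrt (1 + t))}.
Proof. by move=> t0; exact: is_derive_continuous (is_derive_1D_sqrt t0). Qed.

Lemma continuous_1D (t : R) : {for t, continuous (fun t : R => 1 + t)}.
Proof. by apply: continuousD; [exact: cst_continuous|exact: cvg_id]. Qed.

Lemma continuous_expRN_1D (a t : R) : 0 <= t ->
  {for t, continuous (fun t : R => expR (- (a / (1 + t))))}.
Proof. by move=> t0; exact: is_derive_continuous (is_derive_expRN_1D a t0). Qed.

(** The exponential is at most 1, and [t^(3/2) <= (1 + t)^(3/2)]. *)
Lemma gauss_sqrt_kernel_ge0 (a t : R) : 0 <= a -> 0 < t -> 0 <= gauss_sqrt_kernel a t.
Proof.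
move=> a0 t0; have t1 : 0 < 1 + t by rewrite addr_gt0.
have st : 0 < Num.sqrt t by rewrite sqrtr_gt0.
have st1 : 0 < Num.sqrt (1 + t) by rewrite sqrtr_gt0.
rewrite subr_ge0; apply: (@le_trans _ _ (t / ((1 + t) * Num.sqrt (1 + t)))).
  rewrite ler_piMr//.
    by rewrite divr_ge0 ?mulr_ge0 ?sqrtr_ge0 ?(ltW t0) ?(ltW t1).
  by rewrite -[leRHS]expR0 ler_expR oppr_le0 divr_ge0// ltW.
rewrite ler_pdivrMr ?mulr_gt0// mulrC ler_pdivlMr//.
rewrite ler_pM ?sqrtr_ge0 ?(ltW t0)//; first by rewrite lerDr.
by rewrite ler_sqrt ?lerDr// ltW.
Qed.

Let continuous_gauss3_explicit (a t : R) : 0 < t ->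
  {for t, continuous (fun t : R => expR (- (a / (1 + t))) *
    (((1 + t) * Num.sqrt (1 + t))^-1 + t * a / ((1 + t) ^+ 2 * Num.sqrt (1 + t))))}.
Proof.
move=> t0; have t1 : 0 < 1 + t by rewrite addr_gt0.
have cv := continuous_1D_sqrt (ltW t0).
have v0 : 0 < Num.sqrt (1 + t) by rewrite sqrtr_gt0.
apply: continuousM; first exact/continuous_expRN_1D/ltW.
apply: continuousD.
  apply: continuousV; first by rewrite gt_eqF ?mulr_gt0.
  by apply: continuousM; [exact: continuous_1D|exact: cv].
apply: continuousM.
  by apply: continuousM; [exact: cvg_id|exact: cst_continuous].
apply: continuousV; first by rewrite gt_eqF ?mulr_gt0.
apply: continuousM; last exact: cv.
by apply: continuousM; exact: continuous_1D.
Qed.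

Lemma measurable_gauss3_integrand (a : R) :
  measurable_fun (`]0%R, +oo[%classic : set R) (gauss3_integrand a).
Proof.
apply: eq_measurable_fun; last first.
  by apply: continuous_measurable_0y => t t0; exact: (@continuous_gauss3_explicit a).
move=> t; rewrite inE/= in_itv/= andbT => t0.
by rewrite gauss3_integrandE// ltW.
Qed.

Lemma continuous_gauss_sqrt_kernel (a t : R) : 0 < t ->
  {for t, continuous (gauss_sqrt_kernel a)}.
Proof.
move=> t0; have t1 : 0 < 1 + t by rewrite addr_gt0.
apply: continuousB.
  by apply: continuousV; [rewrite gt_eqF ?sqrtr_gt0|exact: sqrt_continuous].
apply: continuousM; last exact/continuous_expRN_1D/ltW.
apply: continuousM; first exact: cvg_id.
apply: continuousV; first by rewrite gt_eqF ?mulr_gt0 ?sqrtr_gt0.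
by apply: continuousM; [exact: continuous_1D|exact/continuous_1D_sqrt/ltW].
Qed.

Lemma integral_0y_gauss_sqrt_kernel (a : R) : 0 <= a ->
  (\int[mu]_(t in `]0%R, +oo[) (gauss_sqrt_kernel a t)%:E =
   2%:E * \int[mu]_(t in `]0%R, +oo[) (gauss3_integrand a t)%:E)%E.
Proof.
move=> a0.
pose v (t : R) := Num.sqrt (1 + t).
have v0 (t : R) : 0 < t -> 0 < v t by move=> t0; rewrite sqrtr_gt0 addr_gt0.
pose e (t : R) := expR (- (a / (1 + t))).
pose q (t : R) := 2 * (e t * (((1 + t) * v t)^-1 + t * a / ((1 + t) ^+ 2 * v t))).
have cq (t : R) : 0 < t -> {for t, continuous q}.
  move=> t0; apply: continuousM; first exact: cst_continuous.
  exact: continuous_gauss3_explicit.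
have q0 (t : R) : 0 < t -> 0 <= q t.
  move=> t0; have t1 : 0 < 1 + t by rewrite addr_gt0.
  rewrite mulr_ge0// mulr_ge0 ?expR_ge0// addr_ge0//.
    by rewrite invr_ge0 mulr_ge0 ?ltW// v0.
  by rewrite divr_ge0 ?mulr_ge0 ?(ltW t0) ?(ltW t1) ?(ltW (v0 _ t0)).
transitivity (\int[mu]_(t in `]0%R, +oo[) (q t)%:E + (0 - 0 : R)%:E)%E; last first.
  rewrite subrr adde0 -ge0_integralZl//.
  - apply: eq_integral => t; rewrite inE/= in_itv/= andbT => t0.
    by rewrite gauss3_integrandE ?ltW// -EFinM.
  - by apply/measurable_EFinP; exact: measurable_gauss3_integrand.
  - by move=> t; rewrite /= in_itv/= andbT => t0; rewrite lee_fin gauss3_integrand_ge0// ltW.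
(* The difference of the two integrands is the derivative of this function,
   which vanishes at both ends. *)
apply: (@integral_0y_FTC R (fun t => 2 * Num.sqrt t - 2 * (t * (v t)^-1 * e t))
  (gauss_sqrt_kernel a) q 0 0) => //.
- by move=> t t0; exact: gauss_sqrt_kernel_ge0.
- by move=> t t0; exact: continuous_gauss_sqrt_kernel.
- move=> t t0; have t1 : 0 < 1 + t by rewrite addr_gt0.
  have st : 0 < Num.sqrt t by rewrite sqrtr_gt0.
  have h1 := is_derive_mul (is_derive_cst (2 : R) t (1 : R)) (is_derive1_sqrt t0).
  have h2 : is_derive t 1 (fun t => (v t)^-1) (- (v t) ^- 2 * (2 * v t)^-1) :=
    is_deriveV (lt0r_neq0 (v0 _ t0)) (is_derive_1D_sqrt (ltW t0)).
  have h3 := is_derive_mul (is_derive_mul (is_derive_id t (1 : R)) h2)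
    (is_derive_expRN_1D a (ltW t0)).
  have h4 := is_derive_mul (is_derive_cst (2 : R) t (1 : R)) h3.
  have h := is_deriveB h1 h4.
  refine (is_derive_eq h _); rewrite /q /gauss_sqrt_kernel /e /v /cst.
  (* Eliminating [t] in favour of [w = sqrt (1 + t)] turns the claim into an identity of rational
     functions. *)
  have v2 : 1 + t = Num.sqrt (1 + t) ^+ 2 by rewrite sqr_sqrtr ?ltW.
  have t2 : t = Num.sqrt (1 + t) ^+ 2 - 1 by rewrite -v2 addrC addKr.
  have := v0 _ t0; rewrite /v.
  set E := expR _; move: st; set u := Num.sqrt t => st.
  set w := Num.sqrt (1 + t) in v2 t2 * => w0.
  rewrite v2 t2; field.
  by rewrite !gt_eqF.
- have e00 : 0 - 2 * (0 * (v 0)^-1 * e 0) = 0 :> R by rewrite !mul0r mulr0 subr0.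
  rewrite -[X in _ --> X]e00; apply: cvgB; first exact: sqrt_cvg0.
  apply: cvgM; first exact: cvg_cst.
  apply: cvg_at_right_filter; apply: cvgM; last exact: continuous_expRN_1D.
  apply: cvgM; first exact: cvg_id.
  apply: (@continuousV R R v); first by rewrite gt_eqF// sqrtr_gt0 addr0.
  exact: continuous_1D_sqrt.
(* With [u = sqrt t], [w = sqrt (1 + t)] and [E] the exponential, the claim is
   [0 <= u - u^2 E / w <= (1 + a) / u]. The lower bound uses [E <= 1] and [u <= w]. For the upper
   one, [E >= 1 - a / w^2] splits off a term at most [a / u], and
   [u - u^2 / w = u (w - u) / w <= 1 / w] because [(w - u) (w + u) = 1]. *)
- apply: (@squeeze_cvgr _ _ _ _ (cst 0) (fun t : R => (2 * (1 + a)) / Num.sqrt t)).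
  + near=> t; have t0 : 0 < t by near: t; exact: nbhs_pinfty_gt.
    have t1 : 0 < 1 + t by rewrite addr_gt0.
    have /= := v0 _ t0; have : 0 < Num.sqrt t by rewrite sqrtr_gt0.
    have v2 : v t ^+ 2 = 1 + t by rewrite sqr_sqrtr ?(ltW t1).
    have u2 : Num.sqrt t ^+ 2 = t by rewrite sqr_sqrtr ?(ltW t0).
    have uv : Num.sqrt t <= v t by rewrite ler_sqrt ?lerDr// ltW.
    have e1 : e t <= 1.
      by rewrite -[leRHS]expR0 ler_expR oppr_le0 divr_ge0// ltW.
    have e2 : 1 - a / v t ^+ 2 <= e t by rewrite v2 expR_ge1Dx.
    move: v2 uv e1 e2; rewrite -[X in X / v t]u2; move: u2.
    move: (e t) (v t) (Num.sqrt t) => E w u u2 w2 uw E1 E2 u0 w0.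
    have uw1 : u * (w - u) <= 1.
      have : (w - u) * (w + u) = 1 by rewrite -subr_sqr w2 u2 addrK.
      move=> <-; rewrite mulrC ler_wpM2l ?subr_ge0// lerDr ltW//.
    have uVw : w^-1 <= u^-1 by rewrite lef_pV2.
    have A1 : u ^+ 2 / w <= u by rewrite ler_pdivrMr// expr2 ler_pM2l.
    have A2 : u - u ^+ 2 / w <= u^-1.
      apply: le_trans uVw; rewrite -[leRHS]mul1r -lerBrDr.
      have -> : 1 * w^-1 - - (u ^+ 2 / w) = (1 + u ^+ 2) / w by ring.
      by rewrite ler_pdivlMr//; nra.
    have A3 : u ^+ 2 / w * (a / w ^+ 2) <= a / u.
      have -> : u ^+ 2 / w * (a / w ^+ 2) = a * (u ^+ 2 / w ^+ 2 / w) by field; rewrite gt_eqF.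
      rewrite ler_wpM2l//; apply: le_trans uVw; rewrite ler_piMl ?invr_ge0 ?(ltW w0)//.
      rewrite ler_pdivrMr ?exprn_gt0// mul1r; nra.
    have uw0 : 0 <= u ^+ 2 / w by rewrite divr_ge0 ?exprn_ge0 ?ltW.
    have A4 := ler_wpM2l uw0 E1; have A5 := ler_wpM2l uw0 E2.
    rewrite mulrBr !mulr1 in A4 A5.
    by apply/andP; split; lra.
  + exact: cvg_cst.
  + exact: sqrtV_cvg0.
Unshelve. all: end_near. Qed.
End dimension3_integrand.

(** * Integrability of the one-dimensional integrands *)

Section integrability.
Context (R : realType).
Let mu := @lebesgue_measure R.

(** The function [(1 + t)^(-3/2)] is a common majorant, up to a constant: it is the decay rate of
    [t (1 + t)^(-n/2)] at [n = 5], the slowest case, and that of the integrand in dimension 3. *)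
Let decay (t : R) : R := ((1 + t) * Num.sqrt (1 + t))^-1.

Let decay_ge0 (t : R) : 0 < t -> 0 <= decay t.
Proof. by move=> t0; rewrite invr_ge0 mulr_ge0 ?sqrtr_ge0// addr_ge0// ltW. Qed.

Let continuous_decay (t : R) : 0 < t -> {for t, continuous decay}.
Proof.
move=> t0; have t1 : 0 < 1 + t by rewrite addr_gt0.
apply: continuousV; first by rewrite gt_eqF ?mulr_gt0 ?sqrtr_gt0.
by apply: continuousM; [exact: continuous_1D|exact/continuous_1D_sqrt/ltW].
Qed.

Let measurable_decay : measurable_fun (`]0%R, +oo[%classic : set R) decay.
Proof. by apply: continuous_measurable_0y => t t0; exact: continuous_decay. Qed.

Lemma integral_0y_decay : (\int[mu]_(t in `]0%R, +oo[) (decay t)%:E = 2%:E)%E.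
Proof.
transitivity (\int[mu]_(t in `]0%R, +oo[) (0 : R)%:E + (0 - - 2 : R)%:E)%E; last first.
  by rewrite integral0 add0e sub0r opprK.
have dH (t : R) : 0 <= t -> is_derive t 1 (fun t => - 2 * (Num.sqrt (1 + t))^-1)
    (- 2 * (- (Num.sqrt (1 + t)) ^- 2 * (2 * Num.sqrt (1 + t))^-1)).
  move=> t0; have v0 : Num.sqrt (1 + t) != 0.
    by rewrite gt_eqF// sqrtr_gt0 ltr_wpDr.
  have h1 : is_derive t 1 (fun t => (Num.sqrt (1 + t))^-1) _ :=
    @is_deriveV R (fun t => Num.sqrt (1 + t)) t _ _ v0 (is_derive_1D_sqrt t0).
  have h := is_derive_mul (is_derive_cst (- 2 : R) t (1 : R)) h1.
  by refine (is_derive_eq h _); rewrite mul0r add0r.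
apply: (@integral_0y_FTC R (fun t => - 2 * (Num.sqrt (1 + t))^-1) decay
  (fun=> 0) (- 2) 0) => //.
- by move=> t t0; exact: cst_continuous.
- move=> t t0; have h := dH t (ltW t0); refine (is_derive_eq h _).
  have t1 : 0 < 1 + t by rewrite addr_gt0.
  rewrite /decay sqr_sqrtr ?ltW//.
  have v0 : 0 < Num.sqrt (1 + t) by rewrite sqrtr_gt0.
  by field; rewrite !gt_eqF.
- have e : - 2 * (Num.sqrt (1 + 0))^-1 = - 2 :> R by rewrite addr0 sqrtr1 invr1 mulr1.
  rewrite -[X in _ --> X]e; apply: cvg_at_right_filter.
  exact: is_derive_continuous (dH 0 (lexx 0)).
- apply: (@squeeze_cvgr _ _ _ _ (fun t : R => - 2 / Num.sqrt t) (cst 0)).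
  + near=> t; have t0 : 0 < t by near: t; exact: nbhs_pinfty_gt.
    rewrite !mulNr lerN2 oppr_le0 mulr_ge0 ?invr_ge0 ?sqrtr_ge0// andbT.
    rewrite ler_pM2l// lef_pV2 ?posrE ?sqrtr_gt0 ?addr_gt0//.
    by rewrite ler_sqrt ?lerDr// addr_ge0// ltW.
  + exact: sqrtV_cvg0.
  + exact: cvg_cst.
Unshelve. all: end_near. Qed.

(** Continuity and bounds are at hand on the open half-line, while the theorem integrates over the
    closed one; the endpoint is a null set. *)
Lemma integrable_decay (f : R -> R) (C : R) :
  measurable_fun (`]0%R, +oo[%classic : set R) f ->
  (forall t : R, 0 < t -> 0 <= f t <= C * ((1 + t) * Num.sqrt (1 + t))^-1) ->
  0 <= C -> mu.-integrable `[0, +oo[ (EFin \o f).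
Proof.
move=> mf f01 C0.
have mfE : measurable_fun (`]0%R, +oo[%classic : set R) (EFin \o f).
  by apply/measurable_EFinP.
apply/integrableP; split.
  by apply/emeasurable_fun_itv_obnd_cbndP.
rewrite -integral_itv_obnd_cbnd; last exact: measurableT_comp.
apply: (@le_lt_trans _ _ (\int[mu]_(t in `]0%R, +oo[) (C%:E * (decay t)%:E))%E).
  apply: ge0_le_integral => //.
  - exact: measurableT_comp.
  - by apply: measurable_funeM; apply/measurable_EFinP.
  - move=> t; rewrite /= in_itv/= andbT => t0; have /andP[f0 f1] := f01 t t0.
    by rewrite ger0_norm.
rewrite ge0_integralZl//.
- by rewrite integral_0y_decay -EFinM ltry.
- by apply/measurable_EFinP.
- by move=> t; rewrite /= in_itv/= andbT => t0; rewrite lee_fin decay_ge0.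
Qed.

(** In the constant [1 + a], the term [a] bounds the second summand through [t / (1 + t) <= 1]. *)
Lemma integrable_gauss3 (a : R) : 0 <= a ->
  mu.-integrable `[0, +oo[ (EFin \o gauss3_integrand a).
Proof.
move=> a0; apply: (@integrable_decay _ (1 + a)); last by rewrite addr_ge0.
  exact: measurable_gauss3_integrand.
move=> t t0; have t1 : 0 < 1 + t by rewrite addr_gt0.
have v0 : 0 < Num.sqrt (1 + t) by rewrite sqrtr_gt0.
rewrite gauss3_integrand_ge0 ?(ltW t0)//= gauss3_integrandE ?(ltW t0)//.
apply: (@le_trans _ _ (((1 + t) * Num.sqrt (1 + t))^-1 +
    t * a / ((1 + t) ^+ 2 * Num.sqrt (1 + t)))).
  rewrite ler_piMl//.
    by rewrite addr_ge0 ?invr_ge0 ?divr_ge0 ?mulr_ge0 ?(ltW t0) ?(ltW t1) ?(ltW v0).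
  by rewrite -[leRHS]expR0 ler_expR oppr_le0 divr_ge0// ltW.
rewrite [leRHS]mulrDl mul1r lerD2l.
have -> : t * a / ((1 + t) ^+ 2 * Num.sqrt (1 + t)) =
    (t / (1 + t)) * (a / ((1 + t) * Num.sqrt (1 + t))).
  by field; rewrite !gt_eqF.
rewrite ler_piMl//.
  by rewrite divr_ge0 ?mulr_ge0 ?(ltW t1) ?(ltW v0).
by rewrite ler_pdivrMr// mul1r lerDr.
Qed.

Definition gaussn_integrand (n : nat) (a t : R) : R :=
  expR (- (a / (1 + t))) / (1 + t) `^ (n%:R / 2) * t.

Lemma gaussn_integrand_ge0 n (a t : R) : 0 <= t -> 0 <= gaussn_integrand n a t.
Proof. by move=> t0; rewrite mulr_ge0 ?divr_ge0 ?expR_ge0 ?powR_ge0. Qed.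

Lemma measurable_gaussn_integrand n (a : R) :
  measurable_fun (`]0%R, +oo[%classic : set R) (gaussn_integrand n a).
Proof.
apply: continuous_measurable_0y => t t0; have t1 : 0 < 1 + t by rewrite addr_gt0.
apply: continuousM; last exact: cvg_id.
apply: continuousM; first exact/continuous_expRN_1D/ltW.
apply: continuousV; first by rewrite gt_eqF// powR_gt0.
apply: (@continuous_comp _ _ _ (fun t : R => 1 + t) (@powR R ^~ (n%:R / 2))).
  exact: continuous_1D.
exact: continuous_powR.
Qed.

Lemma integrable_gaussn n (a : R) : (5 <= n)%N -> 0 <= a ->
  mu.-integrable `[0, +oo[ (EFin \o gaussn_integrand n a).
Proof.
move=> n5 a0; apply: (@integrable_decay _ 1) => //.
  exact: measurable_gaussn_integrand.
move=> t t0; have t1 : 0 < 1 + t by rewrite addr_gt0.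
have v0 : 0 < Num.sqrt (1 + t) by rewrite sqrtr_gt0.
rewrite gaussn_integrand_ge0 ?(ltW t0)//= mul1r /gaussn_integrand.
have w0 : 0 < (1 + t) `^ (n%:R / 2) by rewrite powR_gt0.
apply: (@le_trans _ _ (t / (1 + t) `^ (5 / 2))).
  rewrite mulrC ler_pM2l//.
  apply: (@le_trans _ _ ((1 + t) `^ (n%:R / 2))^-1).
    rewrite ler_piMl ?invr_ge0 ?powR_ge0//.
    by rewrite -[leRHS]expR0 ler_expR oppr_le0 divr_ge0// ltW.
  rewrite lef_pV2 ?posrE ?powR_gt0//; apply: ler_powR; first by rewrite lerDl ltW.
  by rewrite ler_pM2r ?invr_gt0// ler_nat.
rewrite powR_5half ?(ltW t1)//.
have -> : t / ((1 + t) ^+ 2 * Num.sqrt (1 + t)) =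
    (t / (1 + t)) * ((1 + t) * Num.sqrt (1 + t))^-1.
  by field; rewrite !gt_eqF.
rewrite ler_piMl//.
  by rewrite invr_ge0 mulr_ge0 ?(ltW t1) ?(ltW v0).
by rewrite ler_pdivrMr// mul1r lerDr.
Qed.
End integrability.

(** * The potentials *)

Section potential_ge5.
Context (R : realType).
Let mu := @lebesgue_measure R.

(** A single real power, correct also at [y = x], gives nonnegativity and measurability in all
    dimensions at once. *)
Lemma biharmonic_integrandE n (f : Rn R n -> R) (x y : Rn R n) :
  biharmonic_integrand f x y = f y * norm_Rn (sub_Rn x y) `^ (4 - n%:R).
Proof.
rewrite /biharmonic_integrand -powR_intmul ?norm_Rn_ge0// -powRN.
by congr (_ * _ `^ _); rewrite rmorphB/= opprB.
Qed.

Lemma measurable_biharmonic_integrand n (x : Rn R n) :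
  measurable_fun setT (biharmonic_integrand (@gauss_Rn R n) x).
Proof.
have -> : biharmonic_integrand (@gauss_Rn R n) x =
    fun y => gauss_Rn y * norm_Rn (sub_Rn x y) `^ (4 - n%:R).
  by apply/funext => y; exact: biharmonic_integrandE.
apply: measurable_funM; first exact: measurable_gauss_Rn.
apply: (@measurableT_comp _ _ _ _ _ _ (@powR R ^~ (4 - n%:R))).
  exact: measurable_powR.
exact: measurable_norm_Rn_sub.
Qed.

Lemma measurable_set1_Rn n (x : Rn R n) : measurable [set x].
Proof.
have -> : [set x] = (fun y => norm_Rn (sub_Rn x y)) @^-1` [set 0].
  apply/seteqP; split => [y -> | y /norm_Rn_sub_eq0//] /=.
  rewrite /norm_Rn big1 ?sqrtr0// => i _.
  by rewrite tnth_mktuple subrr expr0n.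
rewrite -[X in measurable X]setTI.
by apply: measurable_norm_Rn_sub => //; exact: measurable_set1.
Qed.

Lemma measurable_dist2_div n (x : Rn R n) (t : R) :
  measurable_fun setT (fun y => norm_Rn (sub_Rn x y) ^+ 2 / t).
Proof.
apply: measurable_funM => //; apply: measurable_funX.
exact: measurable_norm_Rn_sub.
Qed.

Lemma measurable_gauss_dist2 n (x : Rn R n) (t : R) :
  measurable_fun setT
    (fun y => gauss_Rn y * expR (- (norm_Rn (sub_Rn x y) ^+ 2 / t))).
Proof.
apply: measurable_funM; first exact: measurable_gauss_Rn.
apply: measurableT_comp => //; apply: measurableT_comp => //.
exact: measurable_dist2_div.
Qed.

Lemma biharmonic_integrand_ge0 n (x y : Rn R n) :
  0 <= biharmonic_integrand (@gauss_Rn R n) x y.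
Proof. by rewrite biharmonic_integrandE mulr_ge0 ?gauss_Rn_ge0 ?powR_ge0. Qed.

(** The passage from extended to real integrals. Integrability of [F] makes the right-hand side
    finite; as [c > 0], the nonnegative integrand of the potential then has a finite integral, that
    is, it is integrable. *)
Lemma Rintegral_biharmonic_integrand n (x : Rn R n) (c k : R) (F : R -> R) :
  0 < c -> mu.-integrable `[0, +oo[ (EFin \o F) ->
  (c%:E * \int[lebesgue_Rn R n]_y (biharmonic_integrand (@gauss_Rn R n) x y)%:E =
   k%:E * \int[mu]_(t in `]0%R, +oo[) (F t)%:E)%E ->
  (lebesgue_Rn R n).-integrable setT
    (EFin \o biharmonic_integrand (@gauss_Rn R n) x) /\
  \int[lebesgue_Rn R n]_y biharmonic_integrand (@gauss_Rn R n) x y =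
    k / c * \int[mu]_(t in `[0, +oo[) F t.
Proof.
move=> c0 iF.
have IF : (\int[mu]_(t in `]0%R, +oo[) (F t)%:E =
    (\int[mu]_(t in `[0%R, +oo[) F t)%:E)%E.
  rewrite integral_itv_obnd_cbnd.
    by rewrite /Rintegral fineK//; exact: integrable_fin_num.
  apply/emeasurable_fun_itv_obnd_cbndP.
  by have /integrableP[] := iF.
rewrite IF -EFinM => h.
have J : (\int[lebesgue_Rn R n]_y (biharmonic_integrand (@gauss_Rn R n) x y)%:E =
    (k / c * \int[mu]_(t in `[0%R, +oo[) F t)%:E)%E.
  have : (c^-1%:E * (c%:E * \int[lebesgue_Rn R n]_y
      (biharmonic_integrand (@gauss_Rn R n) x y)%:E) =
      c^-1%:E * (k * \int[mu]_(t in `[0%R, +oo[) F t)%:E)%E by rewrite h.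
  rewrite muleA -EFinM mulVf ?gt_eqF// mul1e => ->.
  by rewrite -EFinM mulrCA mulrA.
split; last by rewrite /Rintegral J.
apply/integrableP; split.
  by apply/measurable_EFinP; exact: measurable_biharmonic_integrand.
under eq_integral do rewrite /= ger0_norm ?biharmonic_integrand_ge0//.
by rewrite J ltry.
Qed.

Lemma integral_gauss_biharmonic_ge5 n (x : Rn R n) : (5 <= n)%N ->
  ((Gamma (n%:R / 2 - 2))%:E *
     \int[lebesgue_Rn R n]_y (biharmonic_integrand (@gauss_Rn R n) x y)%:E =
   (pi `^ (n%:R / 2))%:E *
     \int[mu]_(t in `]0%R, +oo[) (gaussn_integrand n (norm_Rn x ^+ 2) t)%:E)%E.
Proof.
move=> n5; set s := n%:R / 2 - 2.
have s0 : 0 < s.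
  have : 5%:R <= n%:R :> R by rewrite ler_nat.
  by rewrite /s; lra.
(* Dropping the value at [0] makes the identity below hold also at [y = x],
   where the integrand is [0] by convention. *)
pose E (u : R) : R := \1_(`]0%R, +oo[%classic : set R) u * expR (- u).
have mE : measurable_fun setT E.
  apply: measurable_funM; first by apply: measurable_indic; exact: measurable_itv.
  by apply: measurableT_comp => //; exact: measurableT_comp.
have Epos (u : R) : 0 < u -> E u = expR (- u).
  by move=> u0; rewrite /E indicE mem_set ?mul1r//= in_itv/= u0.
have E0 : E 0 = 0 by rewrite /E indicE memNset ?mul0r//= in_itv/= ltxx.
have E_ge0 (u : R) : 0 <= E u by rewrite /E mulr_ge0 ?expR_ge0.
have T := @gauss_Rn_tonelli R n x (@powR R ^~ (- s - 1)) E
  (measurable_powR _) mE (fun t _ => powR_ge0 _ _) (fun u _ => E_ge0 u).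
transitivity (\int[lebesgue_Rn R n]_y \int[mu]_(t in `]0%R, +oo[)
     (gauss_Rn y * (t `^ (- s - 1) * E (norm_Rn (sub_Rn x y) ^+ 2 / t)%R))%:E)%E.
  rewrite -ge0_integralZl//; first last.
  - by rewrite lee_fin ltW// Gamma_gt0.
  - by move=> y _; rewrite lee_fin biharmonic_integrand_ge0.
  - by apply/measurable_EFinP; exact: measurable_biharmonic_integrand.
  apply: eq_integral => y _; rewrite biharmonic_integrandE.
  set r := norm_Rn _; have [r0|r0] := eqVneq r 0.
    rewrite r0 powR0; last by rewrite /s in s0; lra.
    rewrite mulr0 mule0; apply/esym; apply: integral0_eq => t _.
    by rewrite expr0n/= mul0r E0 !mulr0.
  have {}r0 : 0 < r by rewrite lt_neqAle eq_sym r0 norm_Rn_ge0.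
  transitivity (\int[mu]_(t in `]0%R, +oo[) ((gauss_Rn y)%:E *
     (t `^ (- s - 1) * expR (- (r ^+ 2 / t)))%:E))%E; last first.
    by apply: eq_integral => t; rewrite inE/= in_itv/= andbT => t0;
      rewrite Epos// divr_gt0// exprn_gt0.
  rewrite ge0_integralZl//; first last.
  - by rewrite lee_fin gauss_Rn_ge0.
  - move=> t _; rewrite lee_fin.
    by apply: mulr_ge0; [exact: powR_ge0|exact: expR_ge0].
  - apply/measurable_EFinP; apply: continuous_measurable_0y => t t0.
    exact: continuous_powR_expRN_divr.
  rewrite -EFinM mulrCA EFinM; congr (_ * _)%E.
  rewrite integral_0y_Gamma_divr ?exprn_gt0//; congr (_ * _)%:E.
  (* The exponents agree because [- 2 s = 4 - n]. *)
  rewrite -powR_mulrn ?(ltW r0)// -powRrM; congr powR.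
  by rewrite /s; field.
rewrite T -ge0_integralZl//; first last.
- by rewrite lee_fin powR_ge0.
- by move=> t; rewrite /= in_itv/= andbT => t0; rewrite lee_fin gaussn_integrand_ge0// ltW.
- by apply/measurable_EFinP; exact: measurable_gaussn_integrand.
apply: eq_integral => t; rewrite inE/= in_itv/= andbT => t0.
have t1 : 0 < 1 + t by rewrite addr_gt0.
(* For fixed [t] the plain exponential can be restored: it differs from [E] only at [y = x], a null
   set. *)
transitivity (\int[lebesgue_Rn R n]_y ((t `^ (- s - 1))%:E *
     (gauss_Rn y * expR (- (norm_Rn (sub_Rn x y) ^+ 2 / t)))%:E))%E.
  apply: ge0_ae_eq_integral => //.
  - apply/measurable_EFinP; apply: measurable_funM; first exact: measurable_gauss_Rn.
    apply: measurable_funM => //; apply: (@measurableT_comp _ _ _ _ _ _ E) => //.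
    exact: measurable_dist2_div.
  - by apply: measurable_funeM; apply/measurable_EFinP; exact: measurable_gauss_dist2.
  - by move=> y _; rewrite lee_fin mulr_ge0 ?gauss_Rn_ge0// mulr_ge0 ?powR_ge0.
  - move=> y _; apply: mule_ge0; rewrite lee_fin; first exact: powR_ge0.
    by apply: mulr_ge0; [exact: gauss_Rn_ge0|exact: expR_ge0].
  exists [set x]; split.
  - exact: measurable_set1_Rn.
  - by apply: lebesgue_Rn_set1; exact: leq_trans n5.
  - move=> y /= h; apply: contrapT => yx; apply: h => _.
    rewrite Epos; first by rewrite -EFinM mulrCA.
    rewrite divr_gt0// exprn_gt0// lt_neqAle norm_Rn_ge0 andbT eq_sym.
    by apply/eqP => /norm_Rn_sub_eq0.
rewrite ge0_integralZl//; first last.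
- by rewrite lee_fin powR_ge0.
- move=> y _; rewrite lee_fin.
  by apply: mulr_ge0; [exact: gauss_Rn_ge0|exact: expR_ge0].
- by apply/measurable_EFinP; exact: measurable_gauss_dist2.
rewrite integral_gauss_Rn_conv// -!EFinM; congr EFin.
rewrite /gaussn_integrand powRM ?pi_ge0 ?divr_ge0 ?(ltW t1) ?(ltW t0)//.
rewrite powRM ?invr_ge0 ?(ltW t1) ?(ltW t0)//.
(* Since [n/2 = s + 2], cancelling the weight [t^(-s-1)] leaves exactly one factor [t]. *)
have -> : t `^ (n%:R / 2) = t * t `^ (s + 1).
  rewrite -[X in X * _ `^ _]powRr1 ?(ltW t0)// -powRD_gt0//; congr powR.
  by rewrite /s; ring.
have -> : t `^ (- s - 1) = (t `^ (s + 1))^-1 by rewrite -powRN; congr powR; ring.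
have -> : (1 + t)^-1 `^ (n%:R / 2) = ((1 + t) `^ (n%:R / 2))^-1.
  by rewrite -powR_inv1 ?(ltW t1)// -powRrM mulN1r powRN.
have p0 : 0 < t `^ (s + 1) by rewrite powR_gt0.
have p1 : 0 < (1 + t) `^ (n%:R / 2) by rewrite powR_gt0.
by field; rewrite !gt_eqF.
Qed.
End potential_ge5.

(** * The potential integral in dimension 3 *)

Section potential3.
Context (R : realType).
Let mu := @lebesgue_measure R.

(** The total Gaussian mass is the sum of two nonnegative integrals, and the one containing [exp] is
    finite, so it can be subtracted. *)
Lemma integral_gauss_1Bconv n (x : Rn R n) (t : R) : 0 < t ->
  (\int[lebesgue_Rn R n]_y
     (gauss_Rn y * (1 - expR (- (norm_Rn (sub_Rn x y) ^+ 2 / t))))%:E =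
   (pi `^ (n%:R / 2) - (pi * (t / (1 + t))) `^ (n%:R / 2) *
    expR (- (norm_Rn x ^+ 2 / (1 + t))))%:E)%E.
Proof.
move=> t0.
have e1 y : expR (- (norm_Rn (sub_Rn x y) ^+ 2 / t)) <= 1.
  by rewrite -[leRHS]expR0 ler_expR oppr_le0 divr_ge0 ?sqr_ge0// ltW.
have := integral_gauss_Rn R n.
have -> : (\int[lebesgue_Rn R n]_y (gauss_Rn y)%:E =
    \int[lebesgue_Rn R n]_y
      (gauss_Rn y * (1 - expR (- (norm_Rn (sub_Rn x y) ^+ 2 / t))))%:E +
    \int[lebesgue_Rn R n]_y
      (gauss_Rn y * expR (- (norm_Rn (sub_Rn x y) ^+ 2 / t)))%:E)%E.
  rewrite -ge0_integralD//.
  - apply: eq_integral => y _; rewrite -EFinD; congr EFin.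
    by rewrite -mulrDr subrK mulr1.
  - move=> y _; rewrite lee_fin.
    by apply: mulr_ge0; [exact: gauss_Rn_ge0|rewrite subr_ge0; exact: e1].
  - apply/measurable_EFinP; apply: measurable_funM; first exact: measurable_gauss_Rn.
    apply: measurable_funB => //.
    apply: measurableT_comp => //; apply: measurableT_comp => //.
    exact: measurable_dist2_div.
  - move=> y _; rewrite lee_fin.
    by apply: mulr_ge0; [exact: gauss_Rn_ge0|exact: expR_ge0].
  - by apply/measurable_EFinP; exact: measurable_gauss_dist2.
rewrite integral_gauss_Rn_conv// EFinB => <-.
by rewrite addeK.
Qed.

(** The kernel is [|x - y|], the square root of the squared distance. The profile [1 - exp(-u)]
    vanishes at [u = 0], so the point [y = x] fits the superposition without an exception. *)
Lemma integral_gauss_biharmonic3 (x : Rn R 3) :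
  ((2 * Gamma 2^-1)%:E *
     \int[lebesgue_Rn R 3]_y (biharmonic_integrand (@gauss_Rn R 3) x y)%:E =
   (2 * pi `^ (3 / 2))%:E *
     \int[mu]_(t in `]0%R, +oo[) (gauss3_integrand (norm_Rn x ^+ 2) t)%:E)%E.
Proof.
have Vsqrt_ge0 (t : R) : 0 < t -> 0 <= (Num.sqrt t)^-1.
  by move=> _; rewrite invr_ge0 sqrtr_ge0.
have E_ge0 (u : R) : 0 <= u -> 0 <= 1 - expR (- u).
  by move=> u0; rewrite subr_ge0 -[leRHS]expR0 ler_expR oppr_le0.
have mVsqrt : measurable_fun setT (fun t : R => (Num.sqrt t)^-1).
  have -> : (fun t : R => (Num.sqrt t)^-1) = @powR R ^~ (-1) \o @Num.sqrt R.
    by apply/funext => t /=; rewrite powR_inv1 ?sqrtr_ge0.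
  apply: measurableT_comp; first exact: measurable_powR.
  by apply: continuous_measurable_fun; exact: sqrt_continuous.
have mE : measurable_fun setT (fun u : R => 1 - expR (- u)).
  apply: measurable_funB => //.
  by apply: measurableT_comp => //; exact: measurableT_comp.
have T := @gauss_Rn_tonelli R 3 x (fun t => (Num.sqrt t)^-1)
  (fun u => 1 - expR (- u)) mVsqrt mE Vsqrt_ge0 E_ge0.
transitivity (\int[lebesgue_Rn R 3]_y \int[mu]_(t in `]0%R, +oo[)
     (gauss_Rn y * ((Num.sqrt t)^-1 *
       (1 - expR (- (norm_Rn (sub_Rn x y) ^+ 2 / t)))))%:E)%E.
  rewrite -ge0_integralZl//; first last.
  - by rewrite lee_fin mulr_ge0// ltW// Gamma_gt0// invr_gt0.
  - by move=> y _; rewrite lee_fin biharmonic_integrand_ge0.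
  - by apply/measurable_EFinP; exact: measurable_biharmonic_integrand.
  apply: eq_integral => y _; rewrite biharmonic_integrandE.
  set r := norm_Rn _; have r0 : 0 <= r by exact: norm_Rn_ge0.
  under eq_integral do rewrite EFinM.
  rewrite ge0_integralZl//; first last.
  - by rewrite lee_fin gauss_Rn_ge0.
  - move=> t; rewrite /= in_itv/= andbT => t0; rewrite lee_fin.
    apply: mulr_ge0; first exact: Vsqrt_ge0.
    by apply: E_ge0; rewrite divr_ge0 ?sqr_ge0// ltW.
  - apply/measurable_EFinP; apply: continuous_measurable_0y => t t0.
    apply: continuousM.
      by apply: continuousV; [rewrite gt_eqF ?sqrtr_gt0|exact: sqrt_continuous].
    apply: continuousB; first exact: cst_continuous.
    exact: is_derive_continuous (is_derive_expRN_divr _ t0).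
  rewrite integral_0y_sqrt ?sqr_ge0// -!EFinM; congr EFin.
  rewrite sqrtr_sqr ger0_norm// (_ : 4 - 3%:R = 1); last by ring.
  by rewrite powRr1// mulrCA.
rewrite T [2 * _]mulrC EFinM -muleA -integral_0y_gauss_sqrt_kernel ?sqr_ge0//.
rewrite -ge0_integralZl//; first last.
- by rewrite lee_fin powR_ge0.
- by move=> t; rewrite /= in_itv/= andbT => t0;
    rewrite lee_fin gauss_sqrt_kernel_ge0// sqr_ge0.
- by apply/measurable_EFinP; apply: continuous_measurable_0y => t t0;
    exact: continuous_gauss_sqrt_kernel.
apply: eq_integral => t; rewrite inE/= in_itv/= andbT => t0.
have t1 : 0 < 1 + t by rewrite addr_gt0.
under eq_integral do rewrite mulrCA EFinM.
rewrite ge0_integralZl//; first last.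
- move=> y _; rewrite lee_fin; apply: mulr_ge0; first exact: gauss_Rn_ge0.
  by apply: E_ge0; rewrite divr_ge0 ?sqr_ge0// ltW.
- apply/measurable_EFinP; apply: measurable_funM; first exact: measurable_gauss_Rn.
  apply: measurable_funB => //.
  apply: measurableT_comp => //; apply: measurableT_comp => //.
  exact: measurable_dist2_div.
rewrite integral_gauss_1Bconv// -!EFinM; congr EFin.
rewrite powRM ?pi_ge0 ?divr_ge0 ?(ltW t1) ?(ltW t0)//.
have w0 : 0 <= t / (1 + t) by rewrite divr_ge0 ?(ltW t1) ?(ltW t0).
rewrite (powR_3half w0) sqrtrM ?(ltW t0)// sqrtrV ?(ltW t1)//.
rewrite /gauss_sqrt_kernel.
have st : 0 < Num.sqrt t by rewrite sqrtr_gt0.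
have st1 : 0 < Num.sqrt (1 + t) by rewrite sqrtr_gt0.
by field; rewrite !gt_eqF.
Qed.
End potential3.

Theorem theorem5p1 (R : realType) :
  (forall x : Rn R 3,
    let F := fun t : R =>
      expR (- (norm_Rn x ^+ 2 / (1 + t))) *
      (1 / (1 + t) `^ (3 / 2) + t * norm_Rn x ^+ 2 / (1 + t) `^ (5 / 2)) in
    [/\ (lebesgue_Rn R 3).-integrable setT
          (EFin \o biharmonic_integrand (@gauss_Rn R 3) x),
        (@lebesgue_measure R).-integrable `[0, +oo[ (EFin \o F) &
        biharmonic_potential (@gauss_Rn R 3) x =
        - (1 / 8) * \int[@lebesgue_measure R]_(t in `[0, +oo[) F t]) /\
  (forall (n : nat), (5 <= n)%N -> forall x : Rn R n,
    let F := fun t : R =>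
      expR (- (norm_Rn x ^+ 2 / (1 + t))) / (1 + t) `^ (n%:R / 2) * t in
    [/\ (lebesgue_Rn R n).-integrable setT
          (EFin \o biharmonic_integrand (@gauss_Rn R n) x),
        (@lebesgue_measure R).-integrable `[0, +oo[ (EFin \o F) &
        biharmonic_potential (@gauss_Rn R n) x =
        1 / 16 * \int[@lebesgue_measure R]_(t in `[0, +oo[) F t]).
Proof.
have half0 : (0 : R) < 2^-1 by rewrite invr_gt0.
split=> [x F|n n5 x F].
- have iF : lebesgue_measure.-integrable `[0, +oo[ (EFin \o F).
    exact: (integrable_gauss3 (sqr_ge0 (norm_Rn x))).
  have c0 : 0 < 2 * Gamma (2^-1 : R) by rewrite mulr_gt0// Gamma_gt0.
  have [ib vb] := Rintegral_biharmonic_integrand c0 iF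
    (integral_gauss_biharmonic3 x).
  split=> //; rewrite /biharmonic_potential vb.
  (* With [Gamma(3/2) = Gamma(1/2) / 2], the factors [pi^(3/2)] and [Gamma(1/2)] cancel, leaving
     [(1/2) / (4 * 1 * (-1)) = -1/8]; the sign is that of [n - 4]. *)
  have -> : 3%:R / 2 = 2^-1 + 1 :> R by field.
  rewrite GammaS//.
  have g0 : Gamma (2^-1 : R) != 0 by rewrite gt_eqF// Gamma_gt0.
  have p0 : (pi : R) `^ (2^-1 + 1) != 0 by rewrite gt_eqF// powR_gt0// pi_gt0.
  by field; rewrite g0 p0.
- have n5R : 5 <= n%:R :> R by rewrite ler_nat.
  have iF : lebesgue_measure.-integrable `[0, +oo[ (EFin \o F).
    exact: (integrable_gaussn n5 (sqr_ge0 (norm_Rn x))).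
  have s0 : 0 < n%:R / 2 - 2 :> R by lra.
  have c0 := Gamma_gt0 s0.
  have [ib vb] := Rintegral_biharmonic_integrand c0 iF
    (integral_gauss_biharmonic_ge5 x n5).
  split=> //; rewrite /biharmonic_potential vb.
  (* Two steps of the recurrence give [(n/2 - 1) (n/2 - 2) = (n - 2) (n - 4) / 4]; with the 4 in the
     denominator of the potential this makes [1/16]. *)
  have -> : Gamma (n%:R / 2) =
      (n%:R / 2 - 1) * ((n%:R / 2 - 2) * Gamma (n%:R / 2 - 2)) :> R.
    rewrite -GammaS// (_ : n%:R / 2 - 2 + 1 = n%:R / 2 - 1); last by ring.
    by rewrite -GammaS ?subrK//; lra.
  have g0 : Gamma (n%:R / 2 - 2) != 0 :> R by rewrite gt_eqF.
  have p0 : (pi : R) `^ (n%:R / 2) != 0 by rewrite gt_eqF// powR_gt0// pi_gt0.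
  have n2 : n%:R - 2 != 0 :> R by rewrite gt_eqF//; lra.
  have n4 : n%:R - 4 != 0 :> R by rewrite gt_eqF//; lra.
  by field; rewrite g0 p0 n2 n4.
Qed.
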